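(* Let $R$ be a commutative noetherian ring, $\mathfrak a$ an ideal of $R$, and $M$ an $R$-module such that $\operatorname{Supp}_R(M)\subset V(\mathfrak a)$ and $M$ is locally minimax. If $0:_M\mathfrak a$ is finitely generated, then $M$ is an $\mathfrak a$-cofinite minimax module. In particular, this is the case (i.e. $M$ is $\mathfrak a$-cofinite and minimax) if there exists an element $x\in\mathfrak a$ such that $0:_M x$ is $\mathfrak a$-cofinite.
   Context: A module $M$ is minimax if it has a finitely generated submodule $N$ such that $M/N$ is artinian; $M$ is locally minimax if $M_{\mathfrak m}$ is a minimax $R_{\mathfrak m}$-module for every maximal ideal $\mathfrak m$ of $R$. $M$ is $\mathfrak a$-cofinite if $\operatorname{Supp}_R(M)\subset V(\mathfrak a)$ and $\operatorname{Ext}^i_R(R/\mathfrak a,M)$ is finitely generated for every $i$. Here $V(\mathfrak a)$ is the set of prime ideals containing $\mathfrak a$, $0:_M\mathfrak a=\{m\in M\mid \mathfrak a m=0\}$ and $0:_M x=\{m\in M\mid xm=0\}$. *)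

(* Defs.v *)
(* Rings are [comPzRingType], so the zero ring is allowed.  Submodules of [M] are
   the library's [submodClosed M], i.e. boolean predicates; under the classical
   axioms of [boolp] every submodule is of this form. *)
From HB Require Import structures.
From mathcomp Require Import all_boot all_algebra.
From mathcomp Require Import generic_quotient ring_quotient.
From mathcomp Require Import boolp classical_sets functions cardinality fsbigop.
From mathcomp Require Import ring.

Set Implicit Arguments.
Unset Strict Implicit.
Unset Printing Implicit Defensive.

Import GRing.Theory.
Local Open Scope classical_set_scope.
Local Open Scope ring_scope.
Local Open Scope quotient_scope.

Definition submodule_type (R : pzRingType) (M : lmodType R)
  (N : submodClosed M) : Type := {x : M | x \in N}.

Section SubmoduleType.
Variables (R : pzRingType) (M : lmodType R) (N : submodClosed M).
HB.instance Definition _ := SubChoice.on (submodule_type N).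
HB.instance Definition _ := [SubChoice_isSubLmodule of submodule_type N by <:].

Lemma submodule_valP (c : R) (x y : submodule_type N) :
  \val (c *: x + y) = c *: \val x + \val y.
Proof. exact: linearP. Qed.
End SubmoduleType.

Section QuotientModule.
Variables (R : pzRingType) (M : lmodType R) (N : submodClosed M).

Fact submodClosed_zmod : zmod_closed (N : {pred M}).
Proof.
by split=> [|x y Nx Ny]; rewrite ?rpred0// -scaleN1r rpredD// rpredZ.
Qed.

Definition submodule_zmod : zmodClosed M :=
  HB.pack (N : {pred M})
    (GRing.isZmodClosed.Build M (N : {pred M}) submodClosed_zmod).

Definition quotient_module : Type := Quotient.quot submodule_zmod.
HB.instance Definition _ := GRing.Zmodule.on quotient_module.

Definition quotient_map (x : M) : quotient_module := \pi x.

Definition quotient_scale (c : R) (q : quotient_module) : quotient_module :=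
  quotient_map (c *: repr q).

Lemma quotient_mapP x y : quotient_map x = quotient_map y <-> x - y \in N.
Proof.
have := Quotient.idealrBE submodule_zmod x y => E.
by split=> [/eqP|H]; [rewrite -E|apply/eqP; rewrite -E].
Qed.

Lemma quotient_map_surj q : quotient_map (repr q) = q.
Proof. exact: reprK. Qed.

Lemma quotient_mapD : {morph quotient_map : x y / x + y}.
Proof. exact: Quotient.pi_add. Qed.

Lemma quotient_mapZ c x :
  quotient_scale c (quotient_map x) = quotient_map (c *: x).
Proof.
apply/quotient_mapP; rewrite -scalerBr rpredZ//.
exact/quotient_mapP/quotient_map_surj.
Qed.

Fact quotient_scaleA a b q :
  quotient_scale a (quotient_scale b q) = quotient_scale (a * b) q.
Proof. by rewrite -[q]quotient_map_surj !quotient_mapZ scalerA. Qed.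

Fact quotient_scale1 : left_id 1 quotient_scale.
Proof. by move=> q; rewrite -[q]quotient_map_surj !quotient_mapZ scale1r. Qed.

Fact quotient_scaleDr : right_distributive quotient_scale +%R.
Proof.
move=> a p q; rewrite -[p]quotient_map_surj -[q]quotient_map_surj.
by rewrite -quotient_mapD !quotient_mapZ scalerDr quotient_mapD.
Qed.

Fact quotient_scaleDl q : {morph quotient_scale^~ q : a b / a + b}.
Proof.
move=> a b; rewrite -[q]quotient_map_surj.
by rewrite !quotient_mapZ scalerDl quotient_mapD.
Qed.

HB.instance Definition _ := GRing.Zmodule_isLmodule.Build R quotient_module
  quotient_scaleA quotient_scale1 quotient_scaleDr quotient_scaleDl.
End QuotientModule.

Section Finiteness.
Variable R : pzRingType.
Implicit Type M : lmodType R.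

Definition finitely_generated M : Prop :=
  exists (n : nat) (g : 'I_n -> M),
    forall x : M, exists c : 'I_n -> R, x = \sum_(i < n) c i *: g i.

Definition artinian M : Prop :=
  forall N : nat -> submodClosed M,
    (forall k, {subset N k.+1 <= N k}) ->
    exists k, forall l, (k <= l)%N -> N l =i N k.

Definition minimax M : Prop :=
  exists N : submodClosed M,
    finitely_generated (submodule_type N) /\ artinian (quotient_module N).
End Finiteness.

(* Ideals of [R] are submodules of the regular module [R^o]; the unit ideal is
   allowed, unlike for the library's [idealr]. *)
Notation ideal R := (submodClosed R^o).

Definition noetherian_ring (R : comPzRingType) : Prop :=
  forall a : ideal R, finitely_generated (submodule_type a).

Record prime_ideal (R : comPzRingType) := PrimeIdeal {
  prime_carrier :> ideal R;
  prime_proper : (1 : R) \notin prime_carrier;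
  primeM : forall x y : R,
    x * y \in prime_carrier -> (x \in prime_carrier) || (y \in prime_carrier)
}.

Definition maximal_ideal (R : comPzRingType) (m : ideal R) : Prop :=
  (1 : R) \notin m /\
  forall b : ideal R, {subset m <= b} -> b =i m \/ (1 : R) \in b.

Section MaximalIdealsArePrime.
Variables (R : comPzRingType) (m : ideal R).

Definition adjoin_pred (x : R) : {pred R^o} :=
  [pred z | `[< exists2 u : R, u \in m & exists r : R, z = u + r * x >]].

Fact adjoin_submod x : GRing.subsemimod_closed (adjoin_pred x).
Proof.
split; first split.
- apply/asboolP; exists 0; first exact: rpred0.
  by exists 0; rewrite mul0r addr0.
- move=> a b /asboolP[u um [r ->]] /asboolP[v vm [s ->]]; apply/asboolP.
  by exists (u + v); [exact: rpredD|exists (r + s); rewrite mulrDl addrACA].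
- move=> c a /asboolP[u um [r ->]]; apply/asboolP.
  exists (c * u); first exact: (@rpredZ _ _ m c u).
  by exists (c * r); rewrite -mulrA -mulrDr.
Qed.
HB.instance Definition _ x :=
  GRing.isSubmodClosed.Build R R^o (adjoin_pred x) (adjoin_submod x).

Lemma maximal_ideal_prime : maximal_ideal m ->
  forall x y : R, x * y \in m -> (x \in m) || (y \in m).
Proof.
move=> [m1 mmax] x y xym; case: (boolP (x \in m)) => //= xm.
case: (mmax (adjoin_pred x : ideal R)) => [z zm|E|].
- by apply/asboolP; exists z => //; exists 0; rewrite mul0r addr0.
- case/negP: xm; rewrite -E; apply/asboolP.
  exists 0; first exact: rpred0.
  by exists 1; rewrite mul1r add0r.
- move=> /asboolP[u um [r E]]; rewrite -[y]mul1r E mulrDl -mulrA.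
  apply: (@rpredD _ m); last exact: (@rpredZ _ _ m r (x * y)).
  by rewrite mulrC; exact: (@rpredZ _ _ m y u).
Qed.
End MaximalIdealsArePrime.

Definition maximal_prime (R : comPzRingType) (m : ideal R)
  (hm : maximal_ideal m) : prime_ideal R :=
  PrimeIdeal hm.1 (maximal_ideal_prime hm).

Section LocalizationCarrier.
Variables (R : comPzRingType) (S : mulrClosed R) (M : lmodType R).

Definition denominator : Type := {s : R | s \in S}.

(* The extra factor [u] is needed because [S] may contain zero divisors on [M]. *)
Definition loc_eq (x y : M * denominator) : bool :=
  `[< exists2 u : R, u \in S &
        u *: (\val y.2 *: x.1) = u *: (\val x.2 *: y.1) >].

Fact loc_eq_refl : reflexive loc_eq.
Proof. by move=> x; apply/asboolP; exists 1; rewrite ?rpred1. Qed.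

Fact loc_eq_sym : symmetric loc_eq.
Proof.
by move=> x y; apply/asboolP/asboolP => -[u uS E]; exists u.
Qed.

Fact loc_eq_trans : transitive loc_eq.
Proof.
move=> [y [t tS]] [x [s sS]] [z [r rS]].
move=> /asboolP[u uS /= E1] /asboolP[v vS /= E2].
apply/asboolP; exists (u * v * t); rewrite ?rpredM//=.
move/(congr1 (fun w => (v * r) *: w)): E1; rewrite /= !scalerA => E1.
move/(congr1 (fun w => (u * s) *: w)): E2; rewrite /= !scalerA => E2.
have -> : u * v * t * r = v * r * u * t by ring.
have -> : u * v * t * s = u * s * v * t by ring.
by rewrite E1 -E2; congr (_ *: _) => /=; ring.
Qed.

Canonical loc_equiv := EquivRel loc_eq loc_eq_refl loc_eq_sym loc_eq_trans.

Definition loc_module : Type := {eq_quot loc_eq}.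
HB.instance Definition _ : EqQuotient _ loc_eq loc_module :=
  EqQuotient.on loc_module.
HB.instance Definition _ := Choice.on loc_module.

Definition loc_frac (x : M) (s : denominator) : loc_module :=
  \pi_loc_module (x, s).

Lemma loc_fracP x s y t : loc_frac x s = loc_frac y t <->
  exists2 u : R, u \in S & u *: (\val t *: x) = u *: (\val s *: y).
Proof.
split=> [/eqP|H]; first by rewrite /loc_frac eqmodE => /asboolP.
by apply/eqP; rewrite /loc_frac eqmodE; apply/asboolP.
Qed.

Lemma loc_frac_surj (z : loc_module) : z = loc_frac (repr z).1 (repr z).2.
Proof. by rewrite /loc_frac -surjective_pairing reprK. Qed.

Definition den1 : denominator := exist _ 1 (rpred1 S).
Fact denM_subproof (s t : denominator) : \val s * \val t \in S.
Proof. exact: rpredM (valP s) (valP t). Qed.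
Definition denM (s t : denominator) : denominator :=
  exist _ (\val s * \val t) (denM_subproof s t).

Definition loc_zero := loc_frac 0 den1.
Definition loc_opp (z : loc_module) : loc_module :=
  loc_frac (- (repr z).1) (repr z).2.
Definition loc_add (z w : loc_module) : loc_module :=
  loc_frac (\val (repr w).2 *: (repr z).1 + \val (repr z).2 *: (repr w).1)
           (denM (repr z).2 (repr w).2).

Lemma loc_oppE x s : loc_opp (loc_frac x s) = loc_frac (- x) s.
Proof.
have /loc_fracP[u uS E] := loc_frac_surj (loc_frac x s).
by apply/loc_fracP; exists u; rewrite // !scalerN E.
Qed.

Lemma loc_addE x s y t : loc_add (loc_frac x s) (loc_frac y t) =
  loc_frac (\val t *: x + \val s *: y) (denM s t).
Proof.
have /loc_fracP[u uS] := loc_frac_surj (loc_frac x s).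
have /loc_fracP[v vS] := loc_frac_surj (loc_frac y t).
rewrite /loc_add; move: (repr _) (repr _) => [x' s'] [y' t'] /=.
rewrite !scalerA => E2 E1; apply/loc_fracP; exists (u * v); rewrite ?rpredM//=.
rewrite !scalerDr !scalerA.
congr (_ + _).
- transitivity ((v * \val t * \val t') *: ((u * \val s) *: x')).
    by rewrite scalerA; congr (_ *: _) => /=; ring.
  by rewrite -E1 scalerA; congr (_ *: _) => /=; ring.
- transitivity ((u * \val s * \val s') *: ((v * \val t) *: y')).
    by rewrite scalerA; congr (_ *: _) => /=; ring.
  by rewrite -E2 scalerA; congr (_ *: _) => /=; ring.
Qed.

Fact loc_addA : associative loc_add.
Proof.
move=> x y z.
rewrite [x]loc_frac_surj [y]loc_frac_surj [z]loc_frac_surj !loc_addE.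
apply/loc_fracP; exists 1; rewrite ?rpred1//= !scalerDr !scalerA addrA.
by congr (_ *: _ + _ *: _ + _ *: _); ring.
Qed.

Fact loc_addC : commutative loc_add.
Proof.
move=> x y; rewrite [x]loc_frac_surj [y]loc_frac_surj !loc_addE.
apply/loc_fracP; exists 1; rewrite ?rpred1//= addrC.
by congr (_ *: (_ *: _)); ring.
Qed.

Fact loc_add0 : left_id loc_zero loc_add.
Proof.
move=> x; rewrite [x]loc_frac_surj /loc_zero loc_addE.
apply/loc_fracP; exists 1; rewrite ?rpred1//=.
by rewrite scaler0 add0r !scale1r mul1r.
Qed.

Fact loc_addN : left_inverse loc_zero loc_opp loc_add.
Proof.
move=> x; rewrite [x]loc_frac_surj loc_oppE loc_addE.
apply/loc_fracP; exists 1; rewrite ?rpred1//=.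
by rewrite scalerN addNr !scaler0.
Qed.

HB.instance Definition _ :=
  GRing.isZmodule.Build loc_module loc_addA loc_addC loc_add0 loc_addN.

Lemma loc_fracD x s y t : loc_frac x s + loc_frac y t =
  loc_frac (\val t *: x + \val s *: y) (denM s t).
Proof. exact: loc_addE. Qed.
End LocalizationCarrier.

Section LocalizationScaling.
Variables (R : comPzRingType) (S : mulrClosed R) (M : lmodType R).

Definition loc_scale (a : loc_module S R^o) (z : loc_module S M) :
    loc_module S M :=
  loc_frac (((repr a).1 : R) *: (repr z).1) (denM (repr a).2 (repr z).2).

Lemma loc_scaleE (a : R) s (x : M) t :
  loc_scale (@loc_frac R S R^o a s) (loc_frac x t) =
  loc_frac (a *: x) (denM s t).
Proof.
have /loc_fracP[u uS] := loc_frac_surj (@loc_frac R S R^o a s).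
have /loc_fracP[v vS] := loc_frac_surj (loc_frac x t).
rewrite /loc_scale; move: (repr _) (repr _) => [a' s'] [x' t'] /=.
rewrite !scalerA => E2 E1; apply/loc_fracP; exists (u * v); rewrite ?rpredM//=.
have {}E1 : u * \val s' * a = u * \val s * a' := E1.
rewrite !scalerA.
transitivity ((u * \val s * a') *: ((v * \val t) *: x')).
  by rewrite scalerA; congr (_ *: _) => /=; ring.
by rewrite -E1 -E2 scalerA; congr (_ *: _) => /=; ring.
Qed.

Definition loc_one : loc_module S R^o :=
  @loc_frac R S R^o 1 (den1 S).

Fact loc_scale1 : left_id loc_one loc_scale.
Proof.
move=> x; rewrite [x]loc_frac_surj /loc_one loc_scaleE.
by apply/loc_fracP; exists 1; rewrite ?rpred1//= mul1r !scale1r.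
Qed.

Fact loc_scaleDr : right_distributive loc_scale +%R.
Proof.
move=> a x y; rewrite [a]loc_frac_surj [x]loc_frac_surj [y]loc_frac_surj.
rewrite [in LHS]loc_fracD !loc_scaleE loc_fracD.
apply/loc_fracP; exists 1; rewrite ?rpred1//= !scalerDr !scalerA.
by congr (_ *: _ + _ *: _) => /=; ring.
Qed.

Fact loc_scaleDl z : {morph loc_scale^~ z : a b / a + b}.
Proof.
move=> a b /=; rewrite [a]loc_frac_surj [b]loc_frac_surj [z]loc_frac_surj.
rewrite [in LHS]loc_fracD !loc_scaleE loc_fracD.
apply/loc_fracP; exists 1; rewrite ?rpred1//= !scalerDl !scalerDr !scalerA.
by congr (_ *: _ + _ *: _); rewrite /GRing.scale/=; ring.
Qed.
End LocalizationScaling.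

Section LocalizationRing.
Variables (R : comPzRingType) (S : mulrClosed R).

Lemma loc_scaleA (M : lmodType R) (a b : loc_module S R^o)
    (z : loc_module S M) :
  loc_scale a (loc_scale b z) = loc_scale (loc_scale a b) z.
Proof.
rewrite [a]loc_frac_surj [b]loc_frac_surj [z]loc_frac_surj !loc_scaleE.
apply/loc_fracP; exists 1; rewrite ?rpred1//= !scalerA.
by congr (_ *: _); rewrite /GRing.scale/=; ring.
Qed.

Definition loc_ring : Type := loc_module S R^o.
HB.instance Definition _ := GRing.Zmodule.on loc_ring.

Definition loc_mul (a b : loc_ring) : loc_ring := loc_scale a b.

Fact loc_mulC : commutative loc_mul.
Proof.
move=> a b; rewrite /loc_mul [a]loc_frac_surj [b]loc_frac_surj !loc_scaleE.
apply/loc_fracP; exists 1; rewrite ?rpred1//=.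
by rewrite /GRing.scale/=; ring.
Qed.

Fact loc_mulA : associative loc_mul.
Proof. by move=> a b c; exact: loc_scaleA. Qed.

Fact loc_mul1 : left_id (loc_one S : loc_ring) loc_mul.
Proof. exact: loc_scale1. Qed.

Fact loc_mulDl : left_distributive loc_mul +%R.
Proof. by move=> a b c; exact: loc_scaleDl. Qed.

HB.instance Definition _ := GRing.Zmodule_isComPzRing.Build loc_ring
  loc_mulA loc_mulC loc_mul1 loc_mulDl.

HB.instance Definition _ (M : lmodType R) :=
  GRing.Zmodule_isLmodule.Build loc_ring (loc_module S M)
    (@loc_scaleA M) (@loc_scale1 R S M) (@loc_scaleDr R S M)
    (@loc_scaleDl R S M).
End LocalizationRing.

Section LocalizationAtPrime.
Variables (R : comPzRingType) (p : prime_ideal R).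

Definition prime_compl : {pred R} := [pred s | s \notin p].

Fact prime_compl_mulr : mulr_closed prime_compl.
Proof.
split=> [|x y xp yp]; rewrite !inE ?prime_proper//.
by apply/negP => /primeM/orP[]; apply/negP.
Qed.
HB.instance Definition _ := GRing.isMulClosed.Build R prime_compl
  prime_compl_mulr.

Definition local_ring : comPzRingType := loc_ring prime_compl.
Definition local_module (M : lmodType R) : lmodType local_ring :=
  loc_module prime_compl M.
End LocalizationAtPrime.

Definition in_support (R : comPzRingType) (M : lmodType R)
  (p : prime_ideal R) : Prop := exists z : local_module p M, z <> 0.

Definition locally_minimax (R : comPzRingType) (M : lmodType R) : Prop :=
  forall (m : ideal R) (hm : maximal_ideal m),
    minimax (local_module (maximal_prime hm) M).

Section FreeModule.
Variables (R : comPzRingType) (T : choiceType).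

Definition finsupp_pred : {pred (T -> R^o)} :=
  [pred f | `[< finite_set [set x | f x != 0] >]].

Fact finsupp_submod : GRing.subsemimod_closed finsupp_pred.
Proof.
split; first split.
- apply/asboolP; rewrite (_ : [set _ | _] = set0)//.
  by apply/seteqP; split=> x //=; rewrite eqxx.
- move=> f g /asboolP f0 /asboolP g0; apply/asboolP.
  apply: (@sub_finite_set _ _ ([set x | f x != 0] `|` [set x | g x != 0])).
    move=> x /= fgx; case: (eqVneq (f x) 0) => [fx|]; [right|by left].
    by apply: contra_neq fgx => gx; rewrite -[LHS]/(f x + g x) fx gx addr0.
  by rewrite finite_setU.
- move=> c f /asboolP f0; apply/asboolP; apply: sub_finite_set f0 => x /=.
  by apply: contra_neq => fx; rewrite -[LHS]/(c *: f x) fx scaler0.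
Qed.
HB.instance Definition _ :=
  GRing.isSubmodClosed.Build R (T -> R^o) finsupp_pred finsupp_submod.

Definition free_module : Type := submodule_type finsupp_pred.
HB.instance Definition _ := GRing.Lmodule.on free_module.

Definition free_coef (f : free_module) : T -> R :=
  \val (f : submodule_type finsupp_pred).

Lemma free_coefP (c : R) (f g : free_module) x :
  free_coef (c *: f + g) x = c * free_coef f x + free_coef g x.
Proof. by rewrite /free_coef [\val _](submodule_valP c f g). Qed.

Lemma free_coef_supp (f : free_module) :
  exists2 s : seq T, uniq s & forall x, free_coef f x != 0 -> x \in s.
Proof.
have /asboolP/finite_seqP[s fs] := valP (f : submodule_type finsupp_pred).
exists (undup s) => [|x fx]; first exact: undup_uniq.
by rewrite mem_undup; have : [set y | free_coef f y != 0] x := fx; rewrite fs.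
Qed.
End FreeModule.

Section FreeCover.
Variables (R : comPzRingType) (N : lmodType R).

Definition free_eval (f : free_module R N) : N :=
  \sum_(x \in [set: N]) free_coef f x *: x.

Lemma free_evalE (f : free_module R N) (s : seq N) : uniq s ->
  (forall x, free_coef f x != 0 -> x \in s) ->
  free_eval f = \sum_(x <- s) free_coef f x *: x.
Proof.
move=> us fs; rewrite /free_eval (fsbigE s)//.
  by apply: eq_bigl => x; apply: mem_set.
move=> x _ xs; suff -> : free_coef f x = 0 by rewrite scale0r.
by apply/eqP; apply: contraNT xs => /fs.
Qed.

Fact free_eval_linear : linear free_eval.
Proof.
move=> c f g.
have [s us fs] := free_coef_supp f; have [t ut gt] := free_coef_supp g.
have uw : uniq (undup (s ++ t)) by exact: undup_uniq.
rewrite !(free_evalE uw).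
- rewrite scaler_sumr -big_split; apply: eq_bigr => x _ /=.
  by rewrite free_coefP scalerA -scalerDl.
- by move=> x /gt xt; rewrite mem_undup mem_cat xt orbT.
- by move=> x /fs xs; rewrite mem_undup mem_cat xs.
- move=> x; rewrite mem_undup mem_cat; apply: contraR.
  rewrite negb_or => /andP[xs xt]; rewrite free_coefP.
  have /eqP -> : free_coef f x == 0 by apply: contraR xs => /fs.
  have /eqP -> : free_coef g x == 0 by apply: contraR xt => /gt.
  by rewrite mulr0 addr0.
Qed.
HB.instance Definition _ := GRing.isLinear.Build R (free_module R N) N _
  free_eval free_eval_linear.

Definition relations_pred : {pred free_module R N} :=
  [pred f | free_eval f == 0].

Fact relations_submod : GRing.subsemimod_closed relations_pred.
Proof.
split; first split.
- by apply/eqP; exact: linear0.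
- move=> f g /eqP f0 /eqP g0; apply/eqP.
  by apply: etrans (linearD _ _ _) _; rewrite /= f0 g0 addr0.
- move=> c f /eqP f0; apply/eqP.
  by apply: etrans (linearZ _ _) _; rewrite /= f0 scaler0.
Qed.
HB.instance Definition _ := GRing.isSubmodClosed.Build R (free_module R N)
  relations_pred relations_submod.

Lemma free_eval_surj (x : N) : exists f, free_eval f = x.
Proof.
pose d : N -> R^o := fun y => (y == x)%:R.
have dP : d \in @finsupp_pred R N.
  apply/asboolP; apply: (@sub_finite_set _ _ [set x]) => // y.
  by apply: contraNP => /eqP yx; rewrite /d (negbTE yx).
exists (exist _ d dP : submodule_type _).
rewrite (@free_evalE _ [:: x])//; last first.
  by move=> y; rewrite inE /free_coef/= /d; case: (y == x) => //; rewrite eqxx.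
by rewrite big_seq1 /free_coef/= /d eqxx scale1r.
Qed.
End FreeCover.

(* The free resolution ... -> F_1 -> F_0 -> N -> 0 in which [F_i] is free on the
   underlying set of the [i]-th syzygy module, so that it needs no choices. *)
Section FreeResolution.
Variables (R : comPzRingType) (N : lmodType R).

Fixpoint syzygy (i : nat) : lmodType R :=
  if i is j.+1 then submodule_type (@relations_pred R (syzygy j)) else N.

Definition resolution (i : nat) : lmodType R := free_module R (syzygy i).

Definition differential (i : nat) (f : resolution i.+1) : resolution i :=
  \val (free_eval f : submodule_type (@relations_pred R (syzygy i))).

Fact differential_linear i : linear (@differential i).
Proof.
move=> c f g; rewrite /differential.
exact: etrans (congr1 val (@free_eval_linear R (syzygy i.+1) c f g))
  (submodule_valP c _ _).
Qed.
HB.instance Definition _ i := GRing.isLinear.Build R (resolution i.+1)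
  (resolution i) _ (@differential i) (@differential_linear i).

Lemma differential0_exact (y : resolution 0) :
  free_eval y = 0 <-> exists x, differential x = y.
Proof.
split=> [y0|[x <-]]; last exact/eqP/(valP (free_eval x : submodule_type _)).
have yP : y \in @relations_pred R N by apply/eqP.
have [x xy] := @free_eval_surj R (syzygy 1) (exist _ y yP).
by exists x; rewrite /differential xy.
Qed.

Lemma differential_exact i (y : resolution i.+1) :
  differential y = 0 <-> exists x, differential x = y.
Proof.
split=> [y0|[x <-]]; last first.
  have /eqP := valP (free_eval x : submodule_type _).
  by rewrite {1}/differential => ->.
have yP : y \in @relations_pred R (syzygy i.+1) by apply/eqP/val_inj.
have [x xy] := @free_eval_surj R (syzygy i.+2) (exist _ y yP).
by exists x; rewrite /differential xy.
Qed.
End FreeResolution.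

Section HomModule.
Variables (R : comPzRingType) (U V : lmodType R).

Definition Hom : Type := {linear U -> V}.
Definition hom_fun (f : Hom) : {linear U -> V} := f.
Coercion hom_fun : Hom >-> GRing.Linear.type.
HB.instance Definition _ := gen_eqMixin Hom.
HB.instance Definition _ := gen_choiceMixin Hom.
Implicit Types f g h : Hom.

Lemma hom_eq f g : f =1 g -> f = g.
Proof.
case: f g => [f [[p] [q]]] [g [[p'] [q']]] /= /funext E.
case: _ / E in p' q' *.
by rewrite (Prop_irrelevance p p') (Prop_irrelevance q q').
Qed.

Definition hom_zero : Hom := (\0 : U -> V) : {linear U -> V}.
Definition hom_opp f : Hom := (\- f) : {linear U -> V}.
Definition hom_add f g : Hom := (f \+ g) : {linear U -> V}.
Definition hom_scale (c : R) f : Hom := (c \*: f) : {linear U -> V}.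

Fact hom_addA : associative hom_add.
Proof. by move=> f g h; apply: hom_eq => x; exact: addrA. Qed.
Fact hom_addC : commutative hom_add.
Proof. by move=> f g; apply: hom_eq => x; exact: addrC. Qed.
Fact hom_add0 : left_id hom_zero hom_add.
Proof. by move=> f; apply: hom_eq => x; exact: add0r. Qed.
Fact hom_addN : left_inverse hom_zero hom_opp hom_add.
Proof. by move=> f; apply: hom_eq => x; exact: addNr. Qed.
HB.instance Definition _ :=
  GRing.isZmodule.Build Hom hom_addA hom_addC hom_add0 hom_addN.

Fact hom_scaleA a b f : hom_scale a (hom_scale b f) = hom_scale (a * b) f.
Proof. by apply: hom_eq => x; exact: scalerA. Qed.
Fact hom_scale1 : left_id 1 hom_scale.
Proof. by move=> f; apply: hom_eq => x; exact: scale1r. Qed.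
Fact hom_scaleDr : right_distributive hom_scale +%R.
Proof. by move=> a f g; apply: hom_eq => x; exact: scalerDr. Qed.
Fact hom_scaleDl f : {morph hom_scale^~ f : a b / a + b}.
Proof. by move=> a b; apply: hom_eq => x; exact: scalerDl. Qed.
HB.instance Definition _ := GRing.Zmodule_isLmodule.Build R Hom
  hom_scaleA hom_scale1 hom_scaleDr hom_scaleDl.

Lemma hom0E x : (0 : Hom) x = 0. Proof. by []. Qed.
Lemma homDE f g x : (f + g) x = f x + g x. Proof. by []. Qed.
Lemma homZE (c : R) f x : (c *: f) x = c *: f x. Proof. by []. Qed.
End HomModule.

Section Ext.
Variables (R : comPzRingType) (N M : lmodType R).
Local Notation C i := (Hom (resolution N i) M).

Definition cocycle_pred i : {pred C i} :=
  [pred f : C i | `[< forall x, f (differential x) = 0 >]].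
Arguments cocycle_pred i : clear implicits.

Fact cocycle_submod i : GRing.subsemimod_closed (cocycle_pred i).
Proof.
split; first split.
- exact/asboolP.
- move=> f g /asboolP f0 /asboolP g0; apply/asboolP => x.
  by rewrite homDE f0 g0 addr0.
- by move=> c f /asboolP f0; apply/asboolP => x; rewrite homZE f0 scaler0.
Qed.
HB.instance Definition _ i := GRing.isSubmodClosed.Build R (C i)
  (cocycle_pred i) (cocycle_submod i).

(* The complex Hom(F_i, M) is zero in degree -1. *)
Definition is_coboundary (i : nat) : C i -> Prop :=
  match i with
  | 0 => fun f => f = 0
  | j.+1 => fun f => exists g : C j, forall x, f x = g (differential x)
  end.

Lemma coboundary_cocycle i f : @is_coboundary i f -> f \in cocycle_pred i.
Proof.
case: i f => [f ->|i f [g fg]]; apply/asboolP => // x.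
by rewrite fg (differential_exact _).2 ?linear0//; exists x.
Qed.

(* Coboundaries are taken inside the module of cocycles, which contains them all
   by [coboundary_cocycle]. *)
Definition coboundary_pred i : {pred submodule_type (cocycle_pred i)} :=
  [pred f | `[< is_coboundary (\val f) >]].
Arguments coboundary_pred i : clear implicits.

Fact coboundary_submod i : GRing.subsemimod_closed (coboundary_pred i).
Proof.
split; first split.
- by apply/asboolP; case: i => [|i] //=; exists 0.
- case: i => [|i] f g /asboolP/= + /asboolP/= => [f0 g0|[f' ff'] [g' gg']].
    by apply/asboolP; rewrite /= f0 g0 addr0.
  by apply/asboolP; exists (f' + g') => x; rewrite [RHS]homDE -ff' -gg'.
- case: i => [|i] c f /asboolP/= => [f0|[f' ff']]; apply/asboolP.
    by rewrite /= f0 scaler0.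
  by exists (c *: f') => x; rewrite [RHS]homZE -ff'.
Qed.
HB.instance Definition _ i := GRing.isSubmodClosed.Build R
  (submodule_type (cocycle_pred i)) (coboundary_pred i)
  (coboundary_submod i).

(* The i-th cohomology module of Hom(F_*, M), where F_* is the free resolution
   of [N] above; up to isomorphism any projective resolution gives the same. *)
Definition Ext (i : nat) : lmodType R := quotient_module (coboundary_pred i).
End Ext.

Section Cofinite.
Variables (R : comPzRingType) (a : ideal R) (M : lmodType R).

(* Supp(M) is contained in V(a). *)
Definition support_in_V : Prop :=
  forall p : prime_ideal R, in_support M p -> {subset a <= p}.

Definition cofinite : Prop :=
  support_in_V /\ forall i : nat,
      finitely_generated (Ext (quotient_module a) M i).
End Cofinite.

Section Annihilated.
Variables (R : comPzRingType) (M : lmodType R).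

Definition ann_ideal (a : ideal R) : {pred M} :=
  [pred m | `[< forall r : R, r \in a -> r *: m = 0 >]].

Fact ann_ideal_submod a : GRing.subsemimod_closed (ann_ideal a).
Proof.
split; first split.
- by apply/asboolP => r _; exact: scaler0.
- move=> m n /asboolP am /asboolP an; apply/asboolP => r ra.
  by rewrite scalerDr am// an// addr0.
- move=> c m /asboolP am; apply/asboolP => r ra.
  by rewrite scalerA mulrC -scalerA am// scaler0.
Qed.
HB.instance Definition _ a :=
  GRing.isSubmodClosed.Build R M (ann_ideal a) (ann_ideal_submod a).

Definition ann_elt (x : R) : {pred M} := [pred m | x *: m == 0].

Fact ann_elt_submod x : GRing.subsemimod_closed (ann_elt x).
Proof.
split; first split.
- by apply/eqP; exact: scaler0.
- by move=> m n /eqP xm /eqP xn; apply/eqP; rewrite scalerDr xm xn addr0.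
- by move=> c m /eqP xm; apply/eqP; rewrite scalerA mulrC -scalerA xm scaler0.
Qed.
HB.instance Definition _ x :=
  GRing.isSubmodClosed.Build R M (ann_elt x) (ann_elt_submod x).
End Annihilated.
Arguments ann_ideal {R} M a.
Arguments ann_elt {R} M x.

(* Main.v *)
From HB Require Import structures.
From mathcomp Require Import all_boot all_algebra.
From mathcomp Require Import boolp classical_sets functions cardinality fsbigop.
From mathcomp Require Import ring.
Require Import Defs.

Set Implicit Arguments.
Unset Strict Implicit.
Unset Printing Implicit Defensive.

Import GRing.Theory.
Local Open Scope classical_set_scope.
Local Open Scope ring_scope.

(** Let [xs] generate [a], let [N_k] be the submodule of elements of [M] killed by
    the [k]-th power of [a] (it is [tors xs k] below), and write [D_k] for the layer
    [N_(k+1) / N_k].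

    Minimaxness.  Since Supp M is contained in V(a), [M] is the union of the [N_k]
    ([support_tors]), and since [N_1] is finitely generated so is every [N_k]
    ([fg_tors]).  Multiplication by the generators embeds [D_(k+1)] into a power of
    [D_k], so the annihilators of the layers increase, and they are all equal to one
    ideal [J] from some [k] on.  Every prime [p] above [J] is maximal
    ([layer_prime_maximal]).  Indeed no later layer vanishes at [p].  But if [p] were
    strictly inside a maximal ideal [m], minimaxness of [M_m] would make [M_p]
    finitely generated, hence equal to the localisation of some [N_k], and the
    layers beyond that would vanish at [p].  So [R/J] has finite length, hence so
    has [D_k], which is the part of [M/N_k] killed by [a].  As [M/N_k] is
    [a]-torsion, it is artinian ([dcc_torsion_seq]), and [M] is minimax.

    Cofiniteness.  From the exact sequence of [N_k], [M] and [M/N_k] it is enough to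
    treat a finitely generated module ([Ext_fg_fg]) and an artinian [a]-torsion
    module [A] whose [a]-socle is finitely generated ([Ext_artinian]).  The second
    is an induction on the number of generators [x :: xs] of [a].  The chain [x^k A]
    stabilises at a submodule [C] with [xC = C]; the kernel [K] of [x] on [C] falls
    under the induction hypothesis for [xs], and as [x] acts by zero on
    Ext^i(R/a, C), the exact sequence of [x : C -> C] embeds Ext^i(R/a, C) into
    Ext^(i+1)(R/a, K).  So [C] is cofinite, hence [A/C] has a finitely generated
    [a]-socle; being killed by a power of [x] it has a finitely generated
    [xs]-socle as well, and the induction hypothesis applies to it too.

    Ext is computed from a resolution by huge free modules.  Both its finiteness on
    finitely generated modules and the vanishing of [x] on it are obtained by
    building a homotopy on that resolution degree by degree
    ([homotopy_mod_small]).

    If [0 :_M x] is cofinite for some [x] in [a], its Ext^0 is [0 :_M a], which is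
    therefore finitely generated. *)

(** * Canonical maps *)

Section CanonicalMaps.
Variables (R : pzRingType) (V : lmodType R) (N : submodClosed V).

Definition submodule_incl (x : submodule_type N) : V := \val x.

Fact submodule_incl_linear : linear submodule_incl.
Proof. exact: submodule_valP. Qed.
HB.instance Definition _ := GRing.isLinear.Build R (submodule_type N) V _
  submodule_incl submodule_incl_linear.

Fact quotient_map_linear : linear (quotient_map N).
Proof. by move=> c x y; rewrite quotient_mapD -quotient_mapZ. Qed.
HB.instance Definition _ := GRing.isLinear.Build R V (quotient_module N) _
  (quotient_map N) quotient_map_linear.

Lemma submodule_incl_inj : injective submodule_incl.
Proof. exact: val_inj. Qed.

Lemma mem_submodule_incl x : submodule_incl x \in N.
Proof. exact: valP. Qed.

Lemma submodule_incl_image v :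
  v \in N <-> exists w : submodule_type N, submodule_incl w = v.
Proof.
split=> [vN|[w <-]]; last exact: mem_submodule_incl.
by exists (exist _ v vN).
Qed.

Lemma quotient_map_onto (q : quotient_module N) : exists x, quotient_map N x = q.
Proof. by exists (repr q); apply: quotient_map_surj. Qed.

Lemma quotient_map_eq0 x : quotient_map N x = 0 <-> x \in N.
Proof. by rewrite -(linear0 (quotient_map N)) quotient_mapP subr0. Qed.

End CanonicalMaps.

Lemma uniform_bound (T : eqType) (s : seq T) (P : T -> nat -> Prop) :
  (forall t, t \in s -> exists k, P t k) ->
  (forall t k l, (k <= l)%N -> P t k -> P t l) ->
  exists k, forall t, t \in s -> P t k.
Proof.
move=> + Pmono; elim: s => [|t s IH] hP; first by exists 0%N.
have [|k hk] := IH; first by move=> u us; apply: hP; rewrite inE us orbT.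
have [l hl] := hP t (mem_head _ _); exists (maxn k l) => u.
rewrite inE => /orP[/eqP->|/hk]; last by apply: Pmono; apply: leq_maxl.
by apply: Pmono hl; apply: leq_maxr.
Qed.

(** * Submodules as sets, and generation modulo a submodule *)

Section LinearSets.
Variable R : comPzRingType.

Definition linset (V : lmodType R) (P : set V) : Prop :=
  P 0 /\ forall (c : R) x y, P x -> P y -> P (c *: x + y).

Section OneModule.
Variable V : lmodType R.
Implicit Types (P Q Z B : set V) (gs : seq V).

Lemma linsetD P x y : linset P -> P x -> P y -> P (x + y).
Proof. by move=> [_ h] Px Py; rewrite -[x]scale1r; apply: h. Qed.

Lemma linsetZ P c x : linset P -> P x -> P (c *: x).
Proof. by move=> [h0 h] Px; rewrite -[_ *: _]addr0; apply: h. Qed.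

Lemma linsetN P x : linset P -> P x -> P (- x).
Proof. by move=> hP Px; rewrite -scaleN1r; apply: linsetZ. Qed.

Lemma linsetB P x y : linset P -> P x -> P y -> P (x - y).
Proof. by move=> hP Px Py; apply: linsetD => //; apply: linsetN. Qed.

Lemma linset_sum P (I : Type) (s : seq I) (c : I -> R) (g : I -> V) :
  linset P -> (forall i, P (g i)) -> P (\sum_(i <- s) c i *: g i).
Proof.
move=> hP Pg; elim: s => [|i s IH]; first by rewrite big_nil; case: hP.
by rewrite big_cons; apply: linsetD => //; apply: linsetZ.
Qed.

Lemma linset0 : linset ([set 0] : set V).
Proof. by split=> // c x y -> ->; rewrite scaler0 addr0. Qed.

Lemma linsetT : linset ([set: V]).
Proof. by []. Qed.

Lemma linsetI P Q : linset P -> linset Q -> linset (P `&` Q).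
Proof.
move=> [p0 hp] [q0 hq]; split=> // c x y [Px Qx] [Py Qy].
by split; [apply: hp|apply: hq].
Qed.

Lemma linset_submod (N : submodClosed V) : linset [set x | x \in N].
Proof. by split=> [|c x y Nx Ny] /=; rewrite ?rpred0// rpredD// rpredZ. Qed.

Definition linset_pred P : {pred V} := [pred x | `[< P x >]].

Fact linset_pred_closed P : linset P -> GRing.subsemimod_closed (linset_pred P).
Proof.
move=> hP; split; first split.
- by apply/asboolP; case: hP.
- by move=> x y /asboolP Px /asboolP Py; apply/asboolP; apply: linsetD.
- by move=> c x /asboolP Px; apply/asboolP; apply: linsetZ.
Qed.

Definition submod_of P (hP : linset P) : submodClosed V :=
  HB.pack (linset_pred P)
    (GRing.isSubmodClosed.Build R V (linset_pred P) (linset_pred_closed hP)).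

Lemma in_submod_of P (hP : linset P) x : (x \in submod_of hP) <-> P x.
Proof. by split=> [/asboolP|h]; last apply/asboolP. Qed.

Definition line (g : V) B : set V := [set z | exists r : R, B (z - r *: g)].

Lemma linset_line g B : linset B -> linset (line g B).
Proof.
move=> hB; split; first by exists 0; rewrite scale0r subr0; case: hB.
move=> c x y [r hr] [s hs]; exists (c * r + s).
rewrite scalerDl -scalerA opprD addrACA -scalerBr.
by case: hB => _; apply.
Qed.

Lemma sub_line g B : B `<=` line g B.
Proof. by move=> z Bz; exists 0; rewrite scale0r subr0. Qed.

Lemma mem_line g B : linset B -> line g B g.
Proof. by move=> [h0 _]; exists 1; rewrite scale1r subrr. Qed.

Lemma line_sub g B P : linset P -> B `<=` P -> P g -> line g B `<=` P.
Proof.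
move=> hP BP Pg z [r /BP Pz]; rewrite -[z](subrK (r *: g)).
by apply: linsetD => //; apply: linsetZ.
Qed.

(** The submodule generated by [gs] and [B].  The recursion absorbs one generator
    at a time into [B], so inductions on the number of generators keep the shape
    of their statement while [B] grows. *)
Fixpoint adjoin gs B : set V :=
  if gs is g :: gs' then adjoin gs' (line g B) else B.

Lemma linset_adjoin gs B : linset B -> linset (adjoin gs B).
Proof. by elim: gs B => //= g gs IH B hB; apply: IH; apply: linset_line. Qed.

Lemma sub_adjoin gs B : B `<=` adjoin gs B.
Proof.
elim: gs B => [|g gs IH] B z Bz //=.
by apply: IH; apply: sub_line.
Qed.

Lemma adjoin_mono gs B P : B `<=` P -> adjoin gs B `<=` adjoin gs P.
Proof.
elim: gs B P => [|g gs IH] B P BP //=; apply: IH => z [r Bz].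
by exists r; apply: BP.
Qed.

Lemma adjoin_cat s t B : adjoin (s ++ t) B = adjoin t (adjoin s B).
Proof. by elim: s B => //= g s IH B; rewrite IH. Qed.

Lemma adjoin_sub gs B P : linset P -> B `<=` P -> (forall g, g \in gs -> P g) ->
  adjoin gs B `<=` P.
Proof.
move=> hP; elim: gs B => //= g gs IH B BP Pg; apply: IH.
- by apply: line_sub => //; apply: Pg; rewrite mem_head.
- by move=> h hgs; apply: Pg; rewrite inE hgs orbT.
Qed.

Lemma mem_adjoin gs B g : linset B -> g \in gs -> adjoin gs B g.
Proof.
elim: gs B => //= h gs IH B hB; rewrite inE => /orP[/eqP->|ggs].
  by apply: sub_adjoin; apply: mem_line.
by apply: IH => //; apply: linset_line.
Qed.

Lemma adjoin_mapP (I : eqType) (s : seq I) (g : I -> V) B z : uniq s ->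
  adjoin (map g s) B z <-> exists c : I -> R, B (z - \sum_(i <- s) c i *: g i).
Proof.
elim: s B => [|j s IH] B /=.
  move=> _; split; first by exists (fun=> 0); rewrite big_nil subr0.
  by case=> c; rewrite big_nil subr0.
case/andP=> js us; rewrite IH//; split.
- move=> [c [r hz]]; exists (fun i => if i == j then r else c i).
  rewrite big_cons eqxx.
  have -> : \sum_(i <- s) (if i == j then r else c i) *: g i =
            \sum_(i <- s) c i *: g i.
    apply: eq_big_seq => i si; case: eqP => // ij.
    by rewrite -ij si in js.
  by rewrite opprD [- (r *: _) + _]addrC addrA.
- move=> [c]; rewrite big_cons => hz; exists c; exists (c j).
  by move: hz; rewrite opprD [- (c j *: _) + _]addrC addrA.
Qed.

(** When [B] is a submodule of [Z], this is finite generation of the subquotient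
    [Z/B]. *)
Definition fg_mod Z B : Prop :=
  exists2 gs : seq V, (forall g, g \in gs -> Z g) & Z `<=` adjoin gs B.

Lemma fg_mod_sub Z B : Z `<=` B -> fg_mod Z B.
Proof. by move=> ZB; exists [::]. Qed.

Lemma fg_mod_trans Z P B : fg_mod Z P -> fg_mod P B -> P `<=` Z -> fg_mod Z B.
Proof.
move=> [gs Zgs hZ] [hs Phs hP] PZ; exists (hs ++ gs).
  by move=> g; rewrite mem_cat => /orP[/Phs/PZ|/Zgs].
by move=> z /hZ; rewrite adjoin_cat; apply: adjoin_mono.
Qed.

Lemma fg_mod_family Z B (n : nat) (g : 'I_n -> V) : (forall i, Z (g i)) ->
  (forall z, Z z -> exists c : 'I_n -> R, B (z - \sum_i c i *: g i)) ->
  fg_mod Z B.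
Proof.
move=> Zg hZ; exists (map g (index_enum 'I_n)).
  by move=> _ /mapP[i _ ->].
by move=> z /hZ Bz; apply/adjoin_mapP => //; apply: index_enum_uniq.
Qed.

Lemma fg_modP Z B : fg_mod Z B <-> exists (n : nat) (g : 'I_n -> V),
  (forall i, Z (g i)) /\
  (forall z, Z z -> exists c : 'I_n -> R, B (z - \sum_i c i *: g i)).
Proof.
split=> [[gs Zgs hZ]|[n [g [Zg hZ]]]]; last exact: fg_mod_family hZ.
exists (size gs), (fun i => gs`_i); split=> [i|z /hZ].
  by apply: Zgs; apply: mem_nth.
have E : gs = [seq gs`_i | i <- iota 0 (size gs)].
  by rewrite (map_nth_iota0 0 (leqnn _)) take_size.
rewrite [in adjoin _]E.
case/adjoin_mapP => [|c]; first exact: iota_uniq.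
exists (fun i => c (val i)).
by rewrite -(big_mkord xpredT (fun i => c i *: gs`_i)) /index_iota subn0.
Qed.

End OneModule.

Lemma finitely_generatedP (V : lmodType R) :
  finitely_generated V <-> fg_mod [set: V] [set 0].
Proof.
split=> [[n [g hg]]|/fg_modP[n [g [_ hg]]]].
  apply: (fg_mod_family (g := g)) => // z _; have [c ->] := hg z.
  by exists c; rewrite /= subrr.
exists n, g => x; have [//|c /= /eqP] := hg x.
by rewrite subr_eq0 => /eqP; exists c.
Qed.

End LinearSets.

Section Noetherian.
Variable R : comPzRingType.
Hypothesis hR : noetherian_ring R.

Lemma ideal_fg (I : set R^o) : linset I -> fg_mod I [set 0].
Proof.
move=> hI; have [n [g hg]] := hR (submod_of hI).
apply: (fg_mod_family (g := fun i => \val (g i))) => [i|z Iz].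
  exact/(in_submod_of hI)/(valP (g i)).
have zI : z \in submod_of hI by apply/in_submod_of.
have [c E] := hg (exist _ z zI); exists c => /=.
apply/eqP; rewrite subr_eq0; apply/eqP.
have -> : z = submodule_incl (exist _ z zI : submodule_type (submod_of hI)).
  by [].
by rewrite E linear_sum; apply: eq_bigr => i _; rewrite linearZ.
Qed.

(** Finite generation is transported backwards along a linear relation [Rel] from
    [Z] to [Y], up to the part of [Z] related to [C]; subobjects, quotients,
    extensions and connecting maps are all instances.  By induction on the number
    of generators of [Y] modulo [C] it suffices to remove one generator [g]: the
    coefficients of [g] that occur form an ideal, which is finitely generated. *)
Lemma fg_rel (V W : lmodType R) (Rel : V -> W -> Prop) (Z B : set V)
    (Y C : set W) :
  linset Z -> linset C -> Rel 0 0 ->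
  (forall (c : R) x y x' y', Rel x x' -> Rel y y' ->
     Rel (c *: x + y) (c *: x' + y')) ->
  fg_mod Y C -> (forall z, Z z -> exists2 w, Y w & Rel z w) ->
  fg_mod [set z | Z z /\ exists2 w, C w & Rel z w] B ->
  fg_mod Z B.
Proof.
move=> hZ + rel0 relP [gs _ hY] hZY.
have {Y hY hZY} : forall z, Z z -> exists2 w, adjoin gs C w & Rel z w.
  by move=> z /hZY[w /hY]; exists w.
elim: gs C => [|g gs IH] C hZY hC fgB /=.
  apply: fg_mod_trans fgB _; last by move=> z [].
  by apply: fg_mod_sub => z Zz; split=> //; apply: hZY.
apply: (IH (line g C)) => //; first exact: linset_line.
set Z1 := [set _ | _].
apply: fg_mod_trans fgB _; last first.
  by move=> z [Zz [w Cw zw]]; split=> //; exists w => //; apply: sub_line.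
(* [I] collects the coefficients of [g] in elements related to [Z]. *)
pose I : set R^o := [set r | exists z w, [/\ Z z, Rel z w & C (w - r *: g)]].
have hI : linset I.
  split; first by exists 0, 0; split=> //; [case: hZ|rewrite scale0r subr0; case: hC].
  move=> c r s [z [w [Zz zw Cw]]] [z' [w' [Zz' zw' Cw']]].
  exists (c *: z + z'), (c *: w + w'); split; [by case: hZ => _; apply|exact: relP|].
  rewrite scalerDl -scalerA opprD addrACA -scalerBr.
  by case: hC => _; apply.
have /fg_modP[n [r [Ir hr]]] := ideal_fg hI.
have /choice[z /choice[w zw]] := Ir.
apply: (fg_mod_family (g := z)) => [i|x [Zx [y [s Cy] xy]]].
  have [Zz zwi Cw] := zw i; split=> //; exists (w i) => //.
  by exists (r i).
have [|c /= /eqP] := hr s; first by exists x, y.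
rewrite subr_eq0 => /eqP sE; exists c; split.
  by apply: linsetB => //; apply: linset_sum => // i; case: (zw i).
exists (y - \sum_i c i *: w i).
  rewrite -[y](subrK (s *: g)) sE -addrA; apply: linsetD => //.
    by rewrite -sE.
  rewrite scaler_suml -sumrB.
  apply: (big_ind C); [by case: hC|by move=> u v; apply: linsetD|].
  move=> i _.
  have -> : ((c i *: r i : R^o) : R) *: g = c i *: (r i *: g).
    by rewrite scalerA.
  rewrite -scalerBr; apply: linsetZ => //.
  by rewrite -opprB; apply: linsetN => //; case: (zw i).
have relS : Rel (\sum_i c i *: z i) (\sum_i c i *: w i).
  elim/big_rec2: _ => // i y1 y2 _; apply: relP.
  by case: (zw i).
rewrite -[x - _]addrC -[y - _]addrC -![- (\sum_i _)]scaleN1r.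
exact: relP.
Qed.

Lemma fg_rel_sub (V W : lmodType R) (Rel : V -> W -> Prop) (Z B : set V)
    (Y C : set W) :
  linset Z -> linset C -> Rel 0 0 ->
  (forall (c : R) x y x' y', Rel x x' -> Rel y y' ->
     Rel (c *: x + y) (c *: x' + y')) ->
  fg_mod Y C -> (forall z, Z z -> exists2 w, Y w & Rel z w) ->
  (forall z w, Z z -> C w -> Rel z w -> B z) ->
  fg_mod Z B.
Proof.
move=> hZ hC rel0 relP fgY hZY hB; apply: (@fg_rel _ _ Rel Z B Y C) => //.
by apply: fg_mod_sub => z [Zz [w Cw zw]]; apply: hB zw.
Qed.

Lemma fg_mod_subset (V : lmodType R) (Z P B : set V) : linset Z -> linset B ->
  Z `<=` P -> fg_mod P B -> fg_mod Z B.
Proof.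
move=> hZ hB ZP fgP; apply: (@fg_rel_sub V V eq Z B P B) => //.
- by move=> c x y x' y' -> ->.
- by move=> z Zz; exists z => //; apply: ZP.
- by move=> z w _ Cw ->.
Qed.

Lemma fg_mod_map (V W : lmodType R) (phi : {linear W -> V}) (Z B : set V)
    (Y C : set W) :
  linset Z -> linset C -> fg_mod Y C ->
  (forall z, Z z -> exists2 w, Y w & z = phi w) ->
  (forall w, C w -> B (phi w)) -> fg_mod Z B.
Proof.
move=> hZ hC fgY hZY hB.
apply: (@fg_rel_sub V W (fun z w => z = phi w) Z B Y C) => //.
- by rewrite linear0.
- by move=> c x y x' y' -> ->; rewrite linearP.
- by move=> z w _ Cw ->; apply: hB.
Qed.

(** The map [z |-> (phi i z)_(i in s)] to a power of [W], one component at a time. *)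
Lemma fg_mod_forall (I : eqType) (V W : lmodType R) (phi : I -> V -> W)
    (s : seq I) (Z B : set V) (Y C : set W) :
  (forall i, linear (phi i)) -> linset Z -> linset C -> fg_mod Y C ->
  (forall i z, i \in s -> Z z -> Y (phi i z)) ->
  fg_mod [set z | Z z /\ forall i, i \in s -> C (phi i z)] B -> fg_mod Z B.
Proof.
move=> phiP + hC fgY; elim: s Z => [|i s IH] Z hZ hZY fgB.
  have -> : Z = [set z | Z z /\ forall i, i \in [::] -> C (phi i z)].
    by apply/seteqP; split=> z // [].
  exact: fgB.
have phi0 : phi i 0 = 0.
  by have := phiP i (-1) 0 0; rewrite scaler0 addr0 scaleN1r addNr.
apply: (@fg_rel _ _ (fun z w => w = phi i z) Z B Y C) => //.
- by move=> c x y _ _ -> ->; rewrite phiP.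
- by move=> z Zz; exists (phi i z) => //; apply: hZY; rewrite ?mem_head.
apply: IH.
- split; first by split; [case: hZ|exists (phi i 0) => //; rewrite phi0; case: hC].
  move=> c x y [Zx [u Cu ux]] [Zy [v Cv vy]]; split; first by case: hZ => _; apply.
  exists (phi i (c *: x + y)) => //; rewrite phiP -ux -vy.
  by case: hC => _; apply.
- by move=> j z js [Zz _]; apply: hZY => //; rewrite inE js orbT.
congr (fg_mod _ B): fgB; apply/seteqP; split=> z /=.
- move=> [Zz hz]; split; first by split=> //; exists (phi i z) => //; apply/hz/mem_head.
  by move=> j js; apply: hz; rewrite inE js orbT.
- move=> [[Zz [w Cw wE]] hz]; split=> // j; rewrite inE => /orP[/eqP->|/hz//].
  by rewrite -wE.
Qed.

Lemma finitely_generated_submodule (V : lmodType R) (N : submodClosed V) :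
  finitely_generated (submodule_type N) <-> fg_mod [set x | x \in N] [set 0].
Proof.
rewrite finitely_generatedP; split=> fgN.
  apply: (@fg_mod_map _ _ (@submodule_incl _ _ N) _ _ setT [set 0]) => //.
  - exact: linset_submod.
  - exact: linset0.
  - by move=> z Nz; exists (exist _ z Nz).
  - by move=> w ->; rewrite linear0.
apply: (@fg_rel_sub (submodule_type N) V (fun z w => submodule_incl z = w)
  _ _ _ _ _ _ _ _ fgN) => //.
- exact: linset0.
- by move=> c x y x' y' <- <-; apply: linearP.
- by move=> z _; exists (submodule_incl z) => //; apply: mem_submodule_incl.
- by move=> z w _ -> z0; apply: submodule_incl_inj; rewrite z0 linear0.
Qed.

Lemma finitely_generated_quotient (V : lmodType R) (N : submodClosed V) :
  finitely_generated (quotient_module N) <-> fg_mod [set: V] [set x | x \in N].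
Proof.
rewrite finitely_generatedP; split=> fgN.
  apply: (@fg_rel_sub V (quotient_module N) (fun z w => quotient_map N z = w)
    _ _ _ _ _ _ _ _ fgN) => //.
  - exact: linset0.
  - exact: linear0.
  - by move=> c x y x' y' <- <-; apply: linearP.
  - by move=> z _; exists (quotient_map N z).
  - by move=> z w _ -> /quotient_map_eq0.
apply: (@fg_mod_map _ _ (quotient_map N) _ _ _ _ _ _ fgN) => //.
- exact: linset_submod.
- by move=> z _; have [x <-] := quotient_map_onto z; exists x.
- by move=> w Nw; apply/quotient_map_eq0.
Qed.

Lemma ideal_acc (I : nat -> set R^o) : (forall k, linset (I k)) ->
  (forall k, I k `<=` I k.+1) -> exists k, forall l, I l `<=` I k.
Proof.
move=> hI incI.
have mono k l : (k <= l)%N -> I k `<=` I l.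
  move=> /subnK <-; elim: (l - k)%N => // d IH z /IH.
  exact: incI.
pose U : set R^o := [set r | exists k, I k r].
have hU : linset U.
  split; first by exists 0; case: (hI 0).
  move=> c x y [k kx] [l ly]; exists (maxn k l).
  apply: (hI _).2; [apply: mono kx|apply: mono ly].
    exact: leq_maxl.
  exact: leq_maxr.
have [gs Ugs hgs] := ideal_fg hU.
have [k hk] : exists k, forall g, g \in gs -> I k g.
  by apply: uniform_bound => [//|g k l kl]; apply: mono.
exists k => l z lz; have : adjoin gs [set 0] z by apply: hgs; exists l.
apply: adjoin_sub => //; first by move=> _ ->; case: (hI k).
Qed.

Lemma ideal_max (P : set (set R^o)) I0 : P I0 -> (forall I, P I -> linset I) ->
  exists I, [/\ P I, I0 `<=` I & forall I', P I' -> I `<=` I' -> I' `<=` I].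
Proof.
move=> PI0 Plin; apply: contrapT => nmax.
pose T := {I : set R^o | P I /\ I0 `<=` I}.
have step : forall I : T, exists I' : T, sval I `<` sval I'.
  move=> [I [PI II0]]; apply: contrapT => nI; apply: nmax.
  exists I; split=> // I' PI' II'; apply: contrapT => nII'; apply: nI.
  by exists (exist _ I' (conj PI' (subset_trans II0 II'))); split.
have [f hf] := choice step.
pose J k := iter k f (exist _ I0 (conj PI0 (@subset_refl _ I0))).
have [|k|k hk] := @ideal_acc (fun k => sval (J k)).
- by move=> k; apply: Plin; case: (svalP (J k)).
- by case: (hf (J k)).
- by case: (hf (J k)) => _; apply; apply: (hk k.+1).
Qed.

End Noetherian.

(** * The descending chain condition *)

Section DescendingChains.
Variable R : comPzRingType.

Lemma chain_mono (T : Type) (L : nat -> set T) : (forall k, L k.+1 `<=` L k) ->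
  forall k l, (k <= l)%N -> L l `<=` L k.
Proof.
move=> decL k l /subnK <-; elim: (l - k)%N => // d IH z Lz.
by apply: IH; apply: decL.
Qed.

(** For submodules [B] of [Z] this says that [Z/B] is artinian. *)
Definition dcc (V : lmodType R) (Z B : set V) : Prop :=
  forall L : nat -> set V, (forall k, linset (L k)) ->
    (forall k, B `<=` L k) -> (forall k, L k `<=` Z) ->
    (forall k, L k.+1 `<=` L k) -> exists k, forall l, L k `<=` L l.

Section OneModule.
Variable V : lmodType R.
Implicit Types Z B C : set V.

Lemma dcc_refl Z B : Z `<=` B -> dcc Z B.
Proof. by move=> ZB L _ BL LZ _; exists 0%N => l z /LZ/ZB/BL. Qed.

Lemma dcc_subset Z Z' B : Z `<=` Z' -> dcc Z' B -> dcc Z B.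
Proof.
by move=> ZZ' dZ L hL BL LZ; apply: dZ => // k; apply: subset_trans ZZ'.
Qed.

Lemma dcc_trans Z C B : linset Z -> linset C -> B `<=` C -> C `<=` Z ->
  dcc C B -> dcc Z C -> dcc Z B.
Proof.
move=> hZ hC BC CZ dC dZ L hL BL LZ decL.
have mono := chain_mono decL.
have [| | | |k hk] := dC (fun k => L k `&` C).
- by move=> k; apply: linsetI.
- by move=> k z Bz; split; [apply: BL|apply: BC].
- by move=> k z [].
- by move=> k z [Lz Cz]; split=> //; apply: decL.
pose S k : set V := [set z | exists2 y, L k y & C (z - y)].
have [| | | |k' hk'] := dZ S.
- move=> k0; split; first by exists 0; rewrite ?subrr; [case: (hL k0)|case: hC].
  move=> c x y [u Lu Cu] [v Lv Cv]; exists (c *: u + v).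
    by case: (hL k0) => _; apply.
  by rewrite opprD addrACA -scalerBr; case: hC => _; apply.
- by move=> k0 z Cz; exists 0; rewrite ?subr0//; case: (hL k0).
- move=> k0 z [y /LZ Zy /CZ Zzy]; rewrite -[z](subrK y); exact: linsetD.
- by move=> k0 z [y Ly Cz]; exists y => //; apply: decL.
exists (maxn k k') => l z Lz.
have [|y Ly Czy] := hk' (maxn l (maxn k k')) z.
  by exists z; rewrite ?subrr; [apply: mono Lz; apply: leq_maxr|case: hC].
have Ly' : L (maxn k k') y by apply: mono Ly; apply: leq_maxr.
have [|Lzy _] := hk l (z - y).
  split=> //; apply: (mono _ (maxn k k')); first exact: leq_maxl.
  exact: linsetB.
rewrite -[z](subrK y); apply: linsetD => //.
by apply: mono Ly; apply: leq_maxl.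
Qed.

(** If every element of [Z] is killed modulo [B] by a power of [x] and the part
    of [Z] killed by [x] modulo [B] is artinian modulo [B], then so is [Z]: a
    submodule [L] is determined, within any larger one, by the submodules
    [x^k (L cap (B : x^(k+1)))] of that part, and these decrease in [k]. *)
Lemma dcc_torsion (x : R) Z B : linset B ->
  (forall z, Z z -> exists k, B (x ^+ k *: z)) ->
  dcc [set z | Z z /\ B (x *: z)] B -> dcc Z B.
Proof.
move=> hB tors dZ L hL BL LZ decL.
have mono := chain_mono decL.
pose S i k : set V := [set w | exists y,
  [/\ L i y, B (x ^+ k.+1 *: y) & B (w - x ^+ k *: y)]].
have Slin i k : linset (S i k).
  split; first by exists 0; rewrite !scaler0 subr0; split; [case: (hL i)|case: hB..].
  move=> c w w' [y [Ly By Bw]] [y' [Ly' By' Bw']]; exists (c *: y + y'); split.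
  - by case: (hL i) => _; apply.
  - rewrite scalerDr scalerA mulrC -scalerA.
    by case: hB => _; apply.
  - rewrite scalerDr scalerA mulrC -scalerA opprD addrACA -scalerBr.
    by case: hB => _; apply.
have SB i k : B `<=` S i k.
  move=> z Bz; exists 0; rewrite !scaler0 subr0; split=> //; [by case: (hL i)|].
  by case: hB.
have SZ i k : S i k `<=` [set z | Z z /\ B (x *: z)].
  move=> w [y [Ly By Bw]]; split.
    apply: (LZ i); rewrite -[w](subrK (x ^+ k *: y)); apply: linsetD => //.
      exact: BL.
    exact: linsetZ.
  rewrite -[w](subrK (x ^+ k *: y)) scalerDr scalerA -exprS.
  by apply: linsetD => //; apply: linsetZ.
have Sk i k : S i k.+1 `<=` S i k.
  move=> w [y [Ly By Bw]]; exists (x *: y); split; first exact: linsetZ.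
    by rewrite scalerA -exprSr.
  by rewrite scalerA -exprSr.
have Si k i : S i.+1 k `<=` S i k.
  by move=> w [y [Ly By Bw]]; exists y; split=> //; apply: decL.
have Smono i j k l : (i <= j)%N -> (k <= l)%N -> S j l `<=` S i k.
  move=> ij kl w Sw; apply: (chain_mono (Si k) ij).
  exact: (chain_mono (Sk j) kl).
(* The family decreases in both indices, so stability of the diagonal from [i0]
   on gives stability in [i] for all [k >= i0]; the finitely many remaining [k]
   are treated one by one. *)
have [| | | |i0 hi0] := dZ (fun i => S i i) => //.
  by move=> i w Sw; apply: Smono Sw; exact: leqnSn.
have [i1 hi1] : exists i1, forall k, k \in iota 0 i0 ->
    forall l, S i1 k `<=` S l k.
  apply: uniform_bound => [k _|k i j ij Sik l]; first exact: (dZ (S ^~ k)).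
  by apply: subset_trans (Sik l); apply: Smono.
have stab k l : S (maxn i0 i1) k `<=` S l k.
  case: (ltnP k i0) => [ki|ik] w Sw.
    apply: hi1; first by rewrite mem_iota.
    by apply: Smono Sw => //; apply: leq_maxr.
  have {}Sw : S i0 i0 w by apply: Smono Sw => //; apply: leq_maxl.
  by apply: Smono (hi0 (maxn l k) w Sw); rewrite ?leq_maxl ?leq_maxr.
exists (maxn i0 i1) => l.
have key k z : L (maxn i0 i1) z -> B (x ^+ k *: z) -> L l z.
  elim: k z => [|k IH] z Lz Bz; first by apply: BL; rewrite expr0 scale1r in Bz.
  have [|y [Ly _ Bzy]] := stab k (maxn l (maxn i0 i1)) (x ^+ k *: z).
    by exists z; rewrite subrr; split=> //; case: hB.
  rewrite -[z](subrK y); apply: linsetD => //; last first.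
    by apply: mono Ly; apply: leq_maxl.
  apply: IH; last by rewrite scalerBr.
  by apply: linsetB => //; apply: mono Ly; apply: leq_maxr.
by move=> z Lz; have [|k] := tors z; [apply: LZ Lz|apply: key].
Qed.

Lemma dcc_torsion_seq (xs : seq R) Z B : linset B ->
  (forall x z, x \in xs -> Z z -> exists k, B (x ^+ k *: z)) ->
  dcc [set z | Z z /\ forall x, x \in xs -> B (x *: z)] B -> dcc Z B.
Proof.
move=> hB; elim: xs Z => [|x xs IH] Z tors dZ.
  by apply: dcc_subset dZ => z Zz; split.
apply: (dcc_torsion (x := x)) => //.
  by move=> z; apply: tors; rewrite mem_head.
apply: IH => [y z yxs [Zz _]|].
  by apply: tors => //; rewrite inE yxs orbT.
apply: dcc_subset dZ => z [[Zz Bz] hz]; split=> // y.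
by rewrite inE => /orP[/eqP->//|/hz].
Qed.

End OneModule.

Lemma dcc_surj (V W : lmodType R) (phi : {linear V -> W}) (B : set V) :
  (forall w, exists v, phi v = w) -> (forall b, B b -> phi b = 0) ->
  dcc [set: V] B -> dcc [set: W] [set 0].
Proof.
move=> onto phiB dV L hL BL _ decL.
have [| | | |k hk] := dV (fun k => [set v | L k (phi v)]) => //.
- move=> k; split=> [|c x y Lx Ly] /=; first by rewrite linear0; case: (hL k).
  by rewrite linearP; case: (hL k) => _; apply.
- by move=> k z Bz; apply: BL; rewrite /= phiB.
- by move=> k v; apply: decL.
by exists k => l w; have [v <-] := onto w; apply: hk.
Qed.

Lemma dcc_inj (V W : lmodType R) (phi : {linear V -> W}) :
  injective phi -> dcc [set: W] [set 0] -> dcc [set: V] [set 0].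
Proof.
move=> inj dW L hL BL _ decL.
have [| | | |k hk] := dW (fun k => [set w | exists2 v, L k v & phi v = w]) => //.
- move=> k; split; first by exists 0; rewrite ?linear0//; case: (hL k).
  move=> c _ _ [x Lx <-] [y Ly <-]; exists (c *: x + y); last exact: linearP.
  by case: (hL k) => _; apply.
- by move=> k _ ->; exists 0; rewrite ?linear0//; case: (hL k).
- by move=> k _ [v Lv <-]; exists v => //; apply: decL.
by exists k => l v Lv; have [|u Lu /inj <-] := hk l (phi v); first by exists v.
Qed.

Lemma dcc_artinian (V : lmodType R) : dcc [set: V] [set 0] -> artinian V.
Proof.
move=> dV N decN.
have [| | | |k hk] := dV (fun k => [set x | x \in N k]) => //.
- by move=> k; apply: linset_submod.
- by move=> k _ ->; apply: rpred0.
exists k => l kl x; apply/idP/idP; last exact: hk.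
exact: (chain_mono (L := fun k => [set x | x \in N k])) kl x.
Qed.

End DescendingChains.

Section NoetherianDimensionZero.
Variable R : comPzRingType.
Hypothesis hR : noetherian_ring R.
Variables (V : lmodType R) (J : set R^o).
Hypothesis hJ : linset J.
Hypothesis Jmax : forall p : prime_ideal R, J `<=` [set r | r \in p] ->
  maximal_ideal p.

(** By noetherian induction on the annihilator [I] of the generator modulo [B]: if
    [xy] lies in [I] but neither factor does, the cyclic module is an extension of
    two with larger annihilators; if [I] is prime it is maximal, and the cyclic
    module is simple. *)
Lemma dcc_line (B : set V) (g : V) : linset B ->
  (forall r, J r -> B (r *: g)) -> dcc (line g B) B.
Proof.
move=> hB JB; apply: contrapT => ndcc.
(* [P] consists of the ideals above [J] that kill some counterexample. *)
pose P : set (set R^o) := [set I | [/\ linset I, J `<=` I &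
  exists B g, [/\ linset B, forall r : R, I r -> B (r *: g) &
    ~ @dcc R V (line g B) B]]].
have [||I [[hI JI [B' [g' [hB' IB nd']]]] _ maxI]] := @ideal_max _ hR P J.
- by split=> //; exists B, g.
- by move=> I [].
move: B' g' hB' IB nd' {ndcc JB hB} => {}B {}g hB IB ndcc.
have colon_lin (C : set V) h : linset C -> linset ([set r | C (r *: h)] : set R^o).
  move=> hC; split=> [|c x y Cx Cy] /=; first by rewrite scale0r; case: hC.
  by rewrite scalerDl -scalerA; case: hC => _; apply.
have larger (C : set V) h r : linset C -> (forall s : R, I s -> C (s *: h)) ->
    C (r *: h) -> ~ I r -> dcc (line h C) C.
  move=> hC IC Cr nIr; apply: contrapT => nd; apply: nIr.
  apply: (maxI [set s | C (s *: h)]) => //.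
  split; [exact: colon_lin|by move=> s /JI/IC|by exists C, h].
have I1 : ~ I 1.
  move=> /IB; rewrite scale1r => Bg; apply: ndcc; apply: dcc_refl.
  exact: line_sub.
have Iprime : forall x y : R, I (x * y) -> I x \/ I y.
  move=> x y Ixy; apply: contrapT => /not_orP[nIx nIy]; apply: ndcc.
  have hB1 : linset (line (x *: g) B) by apply: linset_line.
  have d1 : dcc (line (x *: g) B) B.
    apply: (larger _ _ y) => // [s Is|]; last by rewrite scalerA mulrC; apply: IB.
    by rewrite scalerA mulrC -scalerA; apply: linsetZ => //; apply: IB.
  have d2 : dcc (line g (line (x *: g) B)) (line (x *: g) B).
    apply: (larger _ _ x) => //; last exact: mem_line.
    by move=> s Is; apply: sub_line; apply: IB.
  apply: dcc_subset (dcc_trans _ _ _ _ d1 d2) => //.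
  - by apply: (@adjoin_mono _ _ [:: g]); apply: sub_line.
  - exact: linset_line.
  - exact: sub_line.
  - exact: sub_line.
have p1 : (1 : R) \notin submod_of hI by apply/negP => /(in_submod_of hI).
have pM : forall x y : R, x * y \in submod_of hI ->
    (x \in submod_of hI) || (y \in submod_of hI).
  move=> x y /(in_submod_of hI)/Iprime[Ix|Iy]; apply/orP; [left|right];
  exact/(in_submod_of hI).
have [|_ mmax] := Jmax (p := PrimeIdeal p1 pM).
  by move=> r Jr; apply/(in_submod_of hI); apply: JI.
apply: ndcc => L hL BL LZ decL.
case: (pselect (forall k, L k g)) => [Lg|/existsNP[k nLg]].
  by exists 0%N => l; apply: subset_trans (LZ 0%N) _; apply: line_sub.
exists k => l z Lz.
pose Q : set R^o := [set r | L k (r *: g)].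
have hQ : linset Q by apply: colon_lin.
have [|QI|] := mmax (submod_of hQ).
- by move=> r /(in_submod_of hI) Ir; apply/(in_submod_of hQ)/BL/IB.
- have [r Br] := LZ k _ Lz; apply: (BL l).
  rewrite -[z](subrK (r *: g)); apply: linsetD => //; apply: IB.
  apply/(in_submod_of hI); rewrite -QI; apply/(in_submod_of hQ).
  rewrite /Q /=.
  rewrite -[r *: g](subKr z); apply: linsetB => //.
  exact: BL.
- by move=> /(in_submod_of hQ); rewrite /Q /= scale1r.
Qed.

Lemma dcc_adjoin (B : set V) (gs : seq V) : linset B ->
  (forall g r, g \in gs -> J r -> B (r *: g)) -> dcc (adjoin gs B) B.
Proof.
elim: gs B => [|g gs IH] B hB JB /=; first exact: dcc_refl.
have hB1 := linset_line g hB.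
apply: (@dcc_trans _ _ _ (line g B)) => //.
- exact: linset_adjoin.
- exact: sub_line.
- exact: sub_adjoin.
- by apply: dcc_line => // r; apply: JB; rewrite mem_head.
- apply: IH => // h r hgs Jr; apply: sub_line; apply: JB => //.
  by rewrite inE hgs orbT.
Qed.

End NoetherianDimensionZero.

(** * The torsion filtration *)

Section TorsionFiltration.
Variables (R : comPzRingType) (M : lmodType R) (xs : seq R).

(** The elements of [M] killed by the [k]-th power of the ideal generated by [xs];
    [tors 1] is the socle [0 :_M xs]. *)
Fixpoint tors (k : nat) : set M :=
  if k is j.+1 then [set m | forall x, x \in xs -> tors j (x *: m)]
  else [set 0].

Lemma linset_tors k : linset (tors k).
Proof.
elim: k => [|k [h0 h]] /=; first exact: linset0.
split=> [x _|c u v hu hv x xxs]; first by rewrite scaler0.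
by rewrite scalerDr scalerA mulrC -scalerA; apply: h; [apply: hu|apply: hv].
Qed.

Lemma tors_step k : tors k `<=` tors k.+1.
Proof.
elim: k => [_ -> x _|k IH m hm x xxs] /=; first by rewrite scaler0.
exact: IH (hm x xxs).
Qed.

Lemma tors_mono k l : (k <= l)%N -> tors k `<=` tors l.
Proof.
by move=> /subnK <-; elim: (l - k)%N => // d IH m /IH; apply: tors_step.
Qed.

Lemma tors_pow k m x : x \in xs -> tors k m -> x ^+ k *: m = 0.
Proof.
move=> xxs; elim: k m => [m ->|k IH m hm]; first by rewrite scaler0.
by rewrite exprSr -scalerA; apply: IH; apply: hm.
Qed.

Definition tors_all : set M := [set m | exists k, tors k m].

Lemma linset_tors_all : linset tors_all.
Proof.
split; first by exists 0%N.
move=> c u v [k hu] [l hv]; exists (maxn k l).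
apply: (linset_tors _).2; first by apply: tors_mono hu; apply: leq_maxl.
by apply: tors_mono hv; apply: leq_maxr.
Qed.

Lemma tors_all_saturated m :
  (forall x, x \in xs -> tors_all (x *: m)) -> tors_all m.
Proof.
move=> hm.
have [|k hk] := @uniform_bound _ xs (fun x k => tors k (x *: m)) hm.
  by move=> x k l kl; apply: tors_mono.
by exists k.+1.
Qed.

Hypothesis hR : noetherian_ring R.

(** Multiplication by [xs] maps [tors k.+1] to a power of [tors k], with kernel
    [tors 1]. *)
Lemma fg_tors k : fg_mod (tors 1) [set 0] -> fg_mod (tors k) [set 0].
Proof.
move=> fg1; elim: k => [|k IH]; first exact: fg_mod_sub.
apply: (@fg_mod_forall _ hR _ M M (fun x m => x *: m) xs _ _ _ _ _ _ _ IH).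
- by move=> x c u v /=; rewrite scalerDr !scalerA mulrC.
- exact: linset_tors.
- exact: linset0.
- by move=> x z xxs; apply.
apply: fg_mod_subset fg1 => //; [|exact: linset0|by move=> m []].
split=> [|c u v [hu hu'] [hv hv']].
  by split=> [|x _]; [case: (linset_tors k.+1)|rewrite /= scaler0].
split; first by apply: (linset_tors k.+1).2.
by move=> x xxs; apply: (linset_tors 1).2.
Qed.

(** Choosing [m] outside the torsion with [(U : m)] maximal makes this ideal a
    prime in the support of [M]; it then contains [xs], and [m] is torsion. *)
Lemma support_tors (a : ideal R) : (forall x, x \in xs -> x \in a) ->
  support_in_V a M -> forall m, tors_all m.
Proof.
move=> xsa hsupp m0; apply: contrapT => nm0.
have hU := linset_tors_all.
pose col m : set R^o := [set r : R | tors_all (r *: m)].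
have hcol m : linset (col m).
  split=> [|c x y Cx Cy]; rewrite /col /=; first by rewrite scale0r; case: hU.
  by rewrite scalerDl -scalerA; case: hU => _; apply.
have [||I [[m nm ->] _ maxI]] := @ideal_max _ hR
  [set I | exists2 m, ~ tors_all m & I = col m] (col m0).
- by exists m0.
- by move=> I [m _ ->].
have p1 : (1 : R) \notin submod_of (hcol m).
  by apply/negP => /(in_submod_of (hcol m)); rewrite /col /= scale1r.
have pM : forall x y : R, x * y \in submod_of (hcol m) ->
    (x \in submod_of (hcol m)) || (y \in submod_of (hcol m)).
  move=> x y /(in_submod_of (hcol m)) xy; apply/orP.
  case: (pselect (col m y)) => [|ny]; first by right; apply/(in_submod_of (hcol m)).
  left; apply/(in_submod_of (hcol m)); apply: (maxI (col (y *: m))).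
  - by exists (y *: m).
  - move=> r rm; rewrite /col /= scalerA mulrC -scalerA; exact: linsetZ.
  - by rewrite /col /= scalerA.
have ap := @hsupp (PrimeIdeal p1 pM).
apply: nm; apply: tors_all_saturated => x /xsa xa.
apply/(in_submod_of (hcol m))/ap => //.
exists (loc_frac m (den1 _)) => /loc_fracP[u up].
rewrite !scaler0 scale1r => um0; case/negP: up.
apply/(in_submod_of (hcol m)); rewrite /col /= um0.
by case: hU.
Qed.

End TorsionFiltration.

(** * Local minimaxness *)

Section FractionsAtPrime.
Variables (R : comPzRingType) (p : prime_ideal R) (M : lmodType R).
Local Notation den := (denominator (prime_compl p)).

Definition lmod_frac (x : M) (t : den) : local_module p M := loc_frac x t.
Definition lring_frac (b : R) (t : den) : local_ring p :=
  @loc_frac R (prime_compl p) R^o b t.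

Lemma lmod_fracP x s y t : lmod_frac x s = lmod_frac y t <->
  exists2 u : R, u \notin p & u *: (\val t *: x) = u *: (\val s *: y).
Proof. exact: loc_fracP. Qed.

Lemma lmod_frac_surj (z : local_module p M) : exists x t, z = lmod_frac x t.
Proof. by do 2!eexists; apply: loc_frac_surj. Qed.

Lemma lring_frac_surj (z : local_ring p) : exists b t, z = lring_frac b t.
Proof. by do 2!eexists; apply: (@loc_frac_surj R _ R^o). Qed.

Lemma lmod_fracZ b t x s :
  lring_frac b t *: lmod_frac x s = lmod_frac (b *: x) (denM t s).
Proof. exact: loc_scaleE. Qed.

Lemma lmod_fracD x s y t : lmod_frac x s + lmod_frac y t =
  lmod_frac (\val t *: x + \val s *: y) (denM s t).
Proof. exact: loc_fracD. Qed.

Lemma lmod_fracN x s : - lmod_frac x s = lmod_frac (- x) s.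
Proof. exact: loc_oppE. Qed.

End FractionsAtPrime.

Section LocallyMinimax.
Variables (R : comPzRingType) (M : lmodType R) (m : ideal R).
Hypothesis hm : maximal_ideal m.

(** On the artinian part of [M_m] the chain generated by the [s^j z] stabilises,
    and as [1 - r s] is invertible in [R_m], some [s^j] kills [z] there.  The
    finitely generated part of [M_m] is generated by the numerators [gs]; clearing
    denominators brings all this back to [M]. *)
Lemma minimax_local_bound : minimax (local_module (maximal_prime hm) M) ->
  exists gs : seq M, forall (s : R) (z : M), s \in m ->
    exists j (u : R), u \notin m /\ adjoin gs [set 0] (u *: (s ^+ j *: z)).
Proof.
set p := maximal_prime hm.
move=> [N [[n [g hg]] artN]].
have /choice[num /choice[dn gE]] : forall i, exists x t,
    submodule_incl (g i) = lmod_frac x t by move=> i; apply: lmod_frac_surj.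
pose gs := map num (index_enum 'I_n); exists gs => s z sm.
have gs0 := linset_adjoin gs (@linset0 R M).
(* The [R_m]-submodule of [M_m] generated by the numerators. *)
pose D : set (local_module p M) :=
  [set w | exists y v, adjoin gs [set 0] y /\ w = lmod_frac y v].
have hD : linset D.
  split; first by exists 0, (den1 _); split=> //; case: gs0.
  move=> c _ _ [x [v [hx ->]]] [y [w [hy ->]]].
  have [b [t ->]] := lring_frac_surj c.
  rewrite lmod_fracZ lmod_fracD; do 2!eexists; split; last by [].
  by apply: linsetD => //; do ?apply: linsetZ.
have ND w : w \in N -> D w.
  move=> wN; have [c E] := hg (exist _ w wN).
  have -> : w = submodule_incl (exist _ w wN : submodule_type N) by [].
  rewrite E linear_sum.
  have -> : \sum_i submodule_incl (c i *: g i)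
    = \sum_i c i *: submodule_incl (g i) by apply: eq_bigr => i _; rewrite linearZ.
  apply: linset_sum => // i; rewrite gE; exists (num i), (dn i); split=> //.
  by apply: mem_adjoin; [exact: linset0|apply: map_f; apply: mem_index_enum].
pose e (k : nat) : quotient_module N :=
  quotient_map N (lmod_frac (s ^+ k *: z) (den1 (prime_compl p))).
pose L (k : nat) : set (quotient_module N) :=
  [set q | exists r : local_ring p, q = r *: e k].
have hL k : linset (L k).
  split; first by exists 0; rewrite scale0r.
  move=> c _ _ [r ->] [r' ->]; exists (c * r + r').
  by rewrite scalerDl scalerA.
have eS k : e k.+1 = lring_frac s (den1 (prime_compl p)) *: e k.
  rewrite /e -linearZ /= lmod_fracZ; congr quotient_map.
  apply/lmod_fracP; exists 1; first exact: prime_proper.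
  by rewrite /= mulr1 !scale1r scalerA exprS.
have [|k hk] := artN (fun k => submod_of (hL k)).
  move=> k q /(in_submod_of (hL k.+1))[r0 ->]; apply/(in_submod_of (hL k)).
  by exists (r0 * lring_frac s (den1 (prime_compl p))); rewrite eS scalerA.
have : e k \in submod_of (hL k).
  by apply/(in_submod_of (hL k)); exists 1; rewrite scale1r.
rewrite -(hk k.+1) // => /(in_submod_of (hL k.+1))[r].
have [b [t ->]] := lring_frac_surj r.
rewrite /e -linearZ => /quotient_mapP /ND.
rewrite /= lmod_fracZ lmod_fracN lmod_fracD => -[y [v [hy]]].
move=> /lmod_fracP[w wm].
rewrite /= mulr1 mul1r !scale1r => E.
have tm : \val t \notin m := valP t.
have vm : \val v \notin m := valP v.
(* [t - b s] is the numerator of [1 - r s], for [r] the fraction [b / t]. *)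
exists k, (w * \val v * (\val t - b * s)); split; last first.
  have <- : w *: (\val t *: y) =
      w * \val v * (\val t - b * s) *: (s ^+ k *: z).
    rewrite -E !scalerA -scalerBl !scalerA; congr (_ *: _).
    by rewrite exprS /=; ring.
  by do ?apply: linsetZ.
have nM x y' : x \notin m -> y' \notin m -> x * y' \notin m.
  move=> xm ym; apply/negP => /(maximal_ideal_prime hm).
  by rewrite (negbTE xm) (negbTE ym).
apply: (nM); first exact: (nM).
apply: contraNN tm => tm; rewrite -[\val t](subrK (b * s)).
by apply: (@rpredD _ m) => //; apply: (@rpredZ _ _ m b s).
Qed.

End LocallyMinimax.

Section Minimaxness.
Variables (R : comPzRingType) (M : lmodType R) (xs : seq R).
Hypothesis hR : noetherian_ring R.
Hypothesis hloc : locally_minimax M.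
Hypothesis htors : forall m : M, tors_all xs m.
Hypothesis fg1 : fg_mod (tors xs 1 : set M) [set 0].

(** The annihilator of the layer [tors xs k.+1 / tors xs k]. *)
Definition layer_ann (k : nat) : set R^o :=
  [set r : R | forall m : M, tors xs k.+1 m -> tors xs k (r *: m)].

Lemma linset_layer_ann k : linset (layer_ann k).
Proof.
have hk := linset_tors M xs k.
split=> [m _|c r s hr hs m hm]; first by rewrite scale0r; case: hk.
by rewrite scalerDl -scalerA; apply: hk.2; [apply: hr|apply: hs].
Qed.

Lemma layer_ann_step k : layer_ann k `<=` layer_ann k.+1.
Proof.
by move=> r hr m hm x xxs; rewrite scalerA mulrC -scalerA; apply/hr/hm.
Qed.

(** A finitely generated module with annihilator inside [p] does not vanish at
    [p]: multipliers outside [p] killing the generators would have their product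
    in the annihilator. *)
Lemma layer_faithful k (p : prime_ideal R) :
  layer_ann k `<=` [set r | r \in p] ->
  exists2 d : M, tors xs k.+1 d & forall r, tors xs k (r *: d) -> r \in p.
Proof.
move=> Jp; apply: contrapT => nd.
have hd : forall d : M, tors xs k.+1 d ->
    exists2 r, r \notin p & tors xs k (r *: d).
  move=> d hd; apply: contrapT => nr; apply: nd; exists d => // r hr.
  by case: (boolP (r \in p)) => // rp; case: nr; exists r.
have [gs gsT hgs] := fg_tors hR k.+1 fg1.
have hk := linset_tors M xs k.
have [r rp hr] : exists2 r, r \notin p & forall g, g \in gs -> tors xs k (r *: g).
  elim: gs gsT {hgs} => [|g gs IH] gsT; first by exists 1; rewrite ?prime_proper.
  have [|r rp hr] := IH; first by move=> h hh; apply: gsT; rewrite inE hh orbT.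
  have [s sp hs] := hd g (gsT g (mem_head _ _)).
  exists (s * r) => [|h].
    by apply/negP => /primeM; rewrite (negbTE sp) (negbTE rp).
  rewrite inE => /orP[/eqP->|/hr]; last by rewrite -scalerA; apply: linsetZ.
  by rewrite mulrC -scalerA; apply: linsetZ.
case/negP: rp; apply: Jp => m /hgs.
apply: (@adjoin_sub _ _ _ _ [set m | tors xs k (r *: m)]) => //.
- split=> [|c u v] /=; first by rewrite scaler0; case: hk.
  by rewrite scalerDr scalerA mulrC -scalerA; apply: hk.2.
- by move=> _ ->; rewrite /= scaler0; case: hk.
Qed.

Lemma exists_maximal_ideal (b : ideal R) : (1 : R) \notin b ->
  exists2 m : ideal R, maximal_ideal m & {subset b <= m}.
Proof.
move=> b1.
have [||I [[hI I1] bI maxI]] := @ideal_max _ hR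
  [set I : set R^o | linset I /\ ~ I 1] [set r | r \in b].
- by split; [apply: linset_submod|apply/negP].
- by move=> I [].
exists (submod_of hI) => [|r rb]; last exact/(in_submod_of hI)/bI.
split=> [|c mc]; first by apply/negP => /(in_submod_of hI).
case: (boolP ((1 : R) \in c)) => c1; [by right|left=> r].
apply/idP/idP => [rc|]; last exact: mc.
apply/(in_submod_of hI); apply: (maxI [set r | r \in c]) => //.
- by split; [apply: linset_submod|apply/negP].
- by move=> x Ix; apply: mc; apply/(in_submod_of hI).
Qed.

(** If [s] lies in a maximal ideal [m] above [p] but not in [p], minimaxness at
    [m] forces a fixed step of the filtration to contain every element up to
    multiples [u s^j] with [u] outside [m]; the layers would vanish at [p]. *)
Lemma layer_prime_maximal k0 (p : prime_ideal R) :
  (forall k, layer_ann k `<=` layer_ann k0) ->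
  layer_ann k0 `<=` [set r | r \in p] -> maximal_ideal p.
Proof.
move=> hk0 Jp; split; first exact: prime_proper.
move=> b pb; apply: contrapT => /not_orP[bp /negP b1].
have [m hm bm] := exists_maximal_ideal b1.
have [s sb sp] : exists2 s, s \in b & s \notin p.
  apply: contrapT => ns; apply: bp => r; apply/idP/idP => [rb|]; last exact: pb.
  by case: (boolP (r \in p)) => // rp; case: ns; exists r.
have [gs hgs] := minimax_local_bound (hloc hm).
have [k gsk] : exists k, forall g, g \in gs -> tors xs k g.
  apply: uniform_bound => [g _|g k l kl]; [exact: htors|exact: tors_mono].
have [|d _ dp] := @layer_faithful k p; first exact: subset_trans (hk0 k) Jp.
have [j [u [um]]] := hgs s d (bm _ sb).
have : adjoin gs [set 0] `<=` tors xs k.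
  apply: adjoin_sub => //; first exact: linset_tors.
  by move=> _ ->; case: (linset_tors M xs k).
move=> /[apply]; rewrite scalerA => /dp /primeM /orP[up|].
  by case/negP: um; apply/bm/pb.
elim: j => [|j IH]; first by rewrite expr0 (negbTE (prime_proper p)).
by rewrite exprS => /primeM; rewrite (negbTE sp) => /IH.
Qed.

(** Once the annihilators have stabilised, the layer is a finitely generated
    module whose annihilator lies only in maximal ideals, hence artinian; it is the
    [xs]-socle of the torsion module [M / tors xs k]. *)
Lemma tors_cofinal_artinian : exists k, dcc [set: M] (tors xs k).
Proof.
have [k hk] := ideal_acc hR linset_layer_ann layer_ann_step; exists k.
have hT := linset_tors M xs k.
apply: (dcc_torsion_seq (xs := xs)) => // [x z xxs _|].
  have [l hl] := htors z; exists l.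
  by rewrite (tors_pow xxs hl); case: hT.
have [gs gsT hgs] := fg_tors hR k.+1 fg1.
apply: (dcc_subset (Z' := adjoin gs (tors xs k))).
  move=> z [_ hz]; apply: (adjoin_mono _ (hgs z hz)).
  by move=> _ ->; case: hT.
apply: (dcc_adjoin hR (linset_layer_ann k)) => //.
  by move=> p; apply: layer_prime_maximal.
by move=> g r /gsT hg; apply.
Qed.

End Minimaxness.

(** * Exact sequences of Ext *)

Section FreeModulesAreProjective.
Variables (R : comPzRingType) (T : choiceType).

Lemma free_coef_inj (f g : free_module R T) : free_coef f =1 free_coef g -> f = g.
Proof. by move=> fg; apply: val_inj; apply/funext. Qed.

Definition basis_coef (t y : T) : R^o := (y == t)%:R.

Fact free_basis_subproof (t : T) : basis_coef t \in @finsupp_pred R T.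
Proof.
apply/asboolP; apply: (@sub_finite_set _ _ [set t]) => // y /=.
by apply: contraNP => /eqP yt; rewrite /basis_coef (negbTE yt).
Qed.

Definition free_basis (t : T) : free_module R T :=
  exist _ (basis_coef t) (free_basis_subproof t) : submodule_type _.

Lemma free_coef_basis t y : free_coef (free_basis t) y = (y == t)%:R.
Proof. by []. Qed.

Lemma free_coef_sum (s : seq T) (c : T -> R) (g : T -> free_module R T) y :
  free_coef (\sum_(t <- s) c t *: g t) y = \sum_(t <- s) c t * free_coef (g t) y.
Proof.
elim: s => [|t s IH]; first by rewrite !big_nil.
by rewrite !big_cons free_coefP IH.
Qed.

Lemma free_expand (f : free_module R T) : exists s : seq T,
  f = \sum_(t <- s) free_coef f t *: free_basis t.
Proof.
have [s us fs] := free_coef_supp f; exists s; apply: free_coef_inj => y.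
rewrite free_coef_sum; case: (boolP (y \in s)) => ys.
  rewrite (bigD1_seq y) //= free_coef_basis eqxx mulr1 big1 ?addr0// => t ty.
  by rewrite free_coef_basis eq_sym (negbTE ty) mulr0.
rewrite big_seq big1 => [|t ts].
  by apply/eqP; apply: contraNT ys => /fs.
rewrite free_coef_basis; case: eqP => [yt|]; last by rewrite mulr0.
by rewrite yt ts in ys.
Qed.

Variables (A : lmodType R) (phi : T -> A).

Definition free_lift (f : free_module R T) : A :=
  \sum_(t \in [set: T]) free_coef f t *: phi t.

Lemma free_liftE (f : free_module R T) (s : seq T) : uniq s ->
  (forall x, free_coef f x != 0 -> x \in s) ->
  free_lift f = \sum_(x <- s) free_coef f x *: phi x.
Proof.
move=> us fs; rewrite /free_lift (fsbigE s)//.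
  by apply: eq_bigl => x; apply: mem_set.
move=> x _ xs; suff -> : free_coef f x = 0 by rewrite scale0r.
by apply/eqP; apply: contraNT xs => /fs.
Qed.

Fact free_lift_linear : linear free_lift.
Proof.
move=> c f g.
have [s _ fs] := free_coef_supp f; have [t _ gt] := free_coef_supp g.
have uw : uniq (undup (s ++ t)) by exact: undup_uniq.
have fw x : free_coef f x != 0 -> x \in undup (s ++ t).
  by move=> /fs xs; rewrite mem_undup mem_cat xs.
have gw x : free_coef g x != 0 -> x \in undup (s ++ t).
  by move=> /gt xt; rewrite mem_undup mem_cat xt orbT.
rewrite !(free_liftE uw) //.
  rewrite scaler_sumr -big_split; apply: eq_bigr => x _ /=.
  by rewrite free_coefP scalerA -scalerDl.
move=> x; apply: contraR => xw; rewrite free_coefP.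
have /eqP -> : free_coef f x == 0 by apply: contraR xw => /fw.
have /eqP -> : free_coef g x == 0 by apply: contraR xw => /gw.
by rewrite mulr0 addr0.
Qed.
HB.instance Definition _ := GRing.isLinear.Build R (free_module R T) A _
  free_lift free_lift_linear.

Lemma free_lift_basis t : free_lift (free_basis t) = phi t.
Proof.
rewrite (@free_liftE _ [:: t])// => [|y].
  by rewrite big_seq1 free_coef_basis eqxx scale1r.
by rewrite free_coef_basis inE; case: (y == t) => //; rewrite eqxx.
Qed.

End FreeModulesAreProjective.

Lemma free_hom_eq (R : comPzRingType) (T : choiceType) (A : lmodType R)
    (f g : {linear free_module R T -> A}) :
  (forall t, f (free_basis R t) = g (free_basis R t)) -> f =1 g.
Proof.
move=> fg x; have [s ->] := free_expand x; rewrite !linear_sum.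
by apply: eq_bigr => t _; rewrite !linearZ /= fg.
Qed.

Lemma free_projective (R : comPzRingType) (T : choiceType) (A B : lmodType R)
    (pr : {linear A -> B}) (f : {linear free_module R T -> B}) :
  (forall x, exists a, pr a = f x) ->
  exists g : {linear free_module R T -> A}, forall x, pr (g x) = f x.
Proof.
move=> hf; have /choice[h hh] : forall t, exists a, pr a = f (free_basis R t).
  by move=> t; apply: hf.
exists (free_lift h).
apply: (@free_hom_eq _ _ _ (pr \o free_lift h) f) => t /=.
by rewrite free_lift_basis.
Qed.

Section Cochains.
Variables (R : comPzRingType) (T : lmodType R).
Local Notation F i := (resolution T i).

Definition hom_comp (U V W : lmodType R) (f : {linear V -> W}) (g : Hom U V) :
  Hom U W := (f \o g : {linear U -> W}).

Definition hom_id (U : lmodType R) : Hom U U := (idfun : {linear U -> U}).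

Definition hom_diff i : Hom (F i.+1) (F i) :=
  (@differential R T i : {linear F i.+1 -> F i}).

Lemma hom_compE (U V W : lmodType R) (f : {linear V -> W}) (g : Hom U V) x :
  hom_comp f g x = f (g x).
Proof. by []. Qed.

Lemma hom_diffE i x : hom_diff i x = differential x.
Proof. by []. Qed.

Lemma differential2 i (x : F i.+2) :
  @differential R T i (@differential R T i.+1 x) = 0.
Proof. by apply/differential_exact; exists x. Qed.

Lemma hom_lift (A B : lmodType R) (pr : {linear A -> B}) i (f : Hom (F i) B) :
  (forall x, exists a, pr a = f x) ->
  exists g : Hom (F i) A, forall x, pr (g x) = f x.
Proof. exact: free_projective. Qed.

Definition cocycles (M : lmodType R) i : set (Hom (F i) M) :=
  [set f : Hom (F i) M | forall x, f (differential x) = 0].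
Definition coboundaries (M : lmodType R) i : set (Hom (F i) M) :=
  [set f : Hom (F i) M | is_coboundary f].

Lemma linset_cocycles M i : linset (@cocycles M i).
Proof.
split=> [x|c f g hf hg x]; first by rewrite hom0E.
by rewrite homDE homZE hf hg scaler0 addr0.
Qed.

Lemma linset_coboundaries M i : linset (@coboundaries M i).
Proof.
case: i => [|i]; first exact: linset0.
split=> [|c f g [u fu] [v gv]]; first by exists 0.
by exists (c *: u + v) => x; rewrite !homDE !homZE fu gv.
Qed.

Lemma coboundaries_comp (A B : lmodType R) (phi : {linear A -> B}) i w :
  @coboundaries A i w -> @coboundaries B i (hom_comp phi w).
Proof.
case: i w => [|i] w /= hw.
  have -> : w = 0 by exact: hw.
  by apply: hom_eq => x; rewrite /= linear0.
by have [k wk] := hw; exists (hom_comp phi k) => x; rewrite /= wk.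
Qed.

Lemma coboundaries_lift (A B : lmodType R) (pr : {linear A -> B}) i w :
  (forall b, exists a, pr a = b) -> @coboundaries B i w ->
  exists2 v, @coboundaries A i v & forall x, w x = pr (v x).
Proof.
move=> onto; case: i w => [|i] w /= hw.
  exists 0 => // x.
  have -> : w = 0 by exact: hw.
  by rewrite !hom0E linear0.
have [k wk] := hw; have [k' kk'] := @hom_lift _ _ pr _ k (fun x => onto _).
exists (hom_comp k' (hom_diff i)); first by exists k'.
by move=> x; rewrite /= wk kk'.
Qed.

Hypothesis hR : noetherian_ring R.

Lemma fg_ExtP M i : finitely_generated (Ext T M i) <->
  fg_mod (@cocycles M i) (@coboundaries M i).
Proof.
apply: iff_trans (finitely_generated_quotient hR _) _; split=> fg.
  apply: (@fg_mod_map _ hR _ _ (@submodule_incl _ _ (@cocycle_pred R T M i))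
    _ _ _ _ _ _ fg).
  - exact: linset_cocycles.
  - exact: linset_submod.
  - move=> f /asboolP fc.
    by exists (exist _ f fc).
  - by move=> f /asboolP.
apply: (@fg_rel_sub _ hR _ _ (fun z w => submodule_incl z = w)
  _ _ _ _ _ _ _ _ fg).
- exact: linsetT.
- exact: linset_coboundaries.
- exact: linear0.
- by move=> c x y _ _ <- <-; apply: linearP.
- by move=> z _; exists (submodule_incl z) => //; apply/asboolP/(valP z).
- by move=> z w _ hw zw; apply/asboolP; rewrite -zw in hw.
Qed.

Section ShortExact.
Variables (A1 A A2 : lmodType R) (inc : {linear A1 -> A}) (pr : {linear A -> A2}).
Hypothesis inc_inj : injective inc.
Hypothesis pr_onto : forall a2, exists a, pr a = a2.
Hypothesis exact_mid : forall a, pr a = 0 <-> exists a1, inc a1 = a.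

Lemma hom_factor i (f : Hom (F i) A) : (forall x, pr (f x) = 0) ->
  exists g : Hom (F i) A1, forall x, inc (g x) = f x.
Proof. by move=> f0; apply: hom_lift => x; apply/exact_mid. Qed.

(** Exactness of H^i(A1) -> H^i(A) -> H^i(A2) in the middle. *)
Lemma Ext_extension i :
  fg_mod (@cocycles A1 i) (@coboundaries A1 i) ->
  fg_mod (@cocycles A2 i) (@coboundaries A2 i) ->
  fg_mod (@cocycles A i) (@coboundaries A i).
Proof.
move=> fg1 fg2.
apply: (@fg_rel _ hR _ _ (fun (f : Hom (F i) A) (w : Hom (F i) A2) =>
  forall x, w x = pr (f x)) _ _ _ _ _ _ _ _ fg2).
- exact: linset_cocycles.
- exact: linset_coboundaries.
- by move=> x; rewrite !hom0E linear0.
- by move=> c f g w w' fw gw x; rewrite !homDE !homZE linearP fw gw.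
- move=> f hf; exists (hom_comp pr f) => // x.
  by rewrite /= hf linear0.
apply: (@fg_rel_sub _ hR _ _ (fun (f : Hom (F i) A) (w : Hom (F i) A1) =>
  exists2 b, coboundaries b & forall x, f x = inc (w x) + b x)
  _ _ _ _ _ _ _ _ fg1).
- split; first split; first exact: (linset_cocycles _ _).1.
    by exists 0; [exact: (linset_coboundaries _ _).1|move=> x; rewrite linear0].
  move=> c f g [hf [w hw fw]] [hg [w' hw' gw']].
  split; first exact: (linset_cocycles _ _).2.
  exists (c *: w + w'); first exact: (linset_coboundaries _ _).2.
  by move=> x; rewrite !homDE !homZE linearP fw gw'.
- exact: linset_coboundaries.
- exists 0; first exact: (linset_coboundaries _ _).1.
  by move=> x; rewrite !hom0E linear0 addr0.
- move=> c f g w w' [b hb fb] [b' hb' gb']; exists (c *: b + b').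
    exact: (linset_coboundaries _ _).2.
  by move=> x; rewrite !homDE !homZE linearP fb gb' scalerDr addrACA.
- move=> f [hf [w hw fw]].
  have [b hb wb] := coboundaries_lift pr_onto hw.
  have [|g gE] := @hom_factor _ (f - b).
    by move=> x; rewrite /= linearB /= -fw wb subrr.
  exists g.
    move=> x; apply: inc_inj; rewrite gE linear0 /= hf.
    by have /asboolP := coboundary_cocycle hb => ->; rewrite subr0.
  by exists b => // x; rewrite gE /= subrK.
- move=> f w [hf _] hw [b hb fE].
  have -> : f = hom_comp inc w + b by apply: hom_eq => x; rewrite fE.
  apply: linsetD => //; first exact: linset_coboundaries.
  exact: coboundaries_comp.
Qed.

(** The connecting map sends [f] to [w] when, for some lift [g] of [f] to [A],
    the composite of [g] with the differential is [w]. *)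
Lemma connecting_exists i (f : Hom (F i) A2) : cocycles f ->
  exists2 w : Hom (F i.+1) A1, cocycles w &
    exists2 g : Hom (F i) A, forall x, f x = pr (g x) &
      forall x, inc (w x) = g (differential x).
Proof.
move=> hf; have [g gE] := @hom_lift _ _ pr _ f (fun x => pr_onto _).
have [|w wE] := @hom_factor _ (hom_comp g (hom_diff i)).
  by move=> x; rewrite hom_compE hom_diffE gE hf.
exists w; last by exists g => // x; rewrite wE hom_compE hom_diffE.
move=> x; apply: inc_inj.
by rewrite wE hom_compE hom_diffE differential2 !linear0.
Qed.

(** If the image [w] of [f] is the coboundary of [k], then the lift [g] can be
    corrected by [k] into a cocycle. *)
Lemma connecting_eq0 i (f : Hom (F i) A2) (w : Hom (F i.+1) A1)
    (g : Hom (F i) A) : coboundaries w -> (forall x, f x = pr (g x)) ->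
  (forall x, inc (w x) = g (differential x)) ->
  exists2 g', cocycles g' & forall x, f x = pr (g' x).
Proof.
move=> [k wk] fg wg; exists (g - hom_comp inc k) => x.
  by rewrite /= -wg wk subrr.
rewrite /= linearB /= -fg.
by rewrite (exact_mid _).2 ?subr0//; eexists.
Qed.

(** Exactness of H^i(A) -> H^i(A2) -> H^(i+1)(A1) in the middle; only the image of
    the first map has to be finitely generated. *)
Lemma Ext_quotient_of_image i :
  fg_mod [set f : Hom (F i) A2 | exists2 g, cocycles g & forall x, f x = pr (g x)]
    (@coboundaries A2 i) ->
  fg_mod (@cocycles A1 i.+1) (@coboundaries A1 i.+1) ->
  fg_mod (@cocycles A2 i) (@coboundaries A2 i).
Proof.
move=> fgA fg1.
apply: (@fg_rel _ hR _ _ (fun (f : Hom (F i) A2) (w : Hom (F i.+1) A1) =>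
  exists2 g : Hom (F i) A, forall x, f x = pr (g x) &
    forall x, inc (w x) = g (differential x)) _ _ _ _ _ _ _ _ fg1).
- exact: linset_cocycles.
- exact: linset_coboundaries.
- by exists 0 => x; rewrite !hom0E linear0.
- move=> c f f' w w' [g fg wg] [g' fg' wg']; exists (c *: g + g') => x.
    by rewrite !homDE !homZE linearP fg fg'.
  by rewrite !homDE !homZE linearP wg wg'.
- exact: connecting_exists.
apply: fg_mod_subset fgA => //.
- split; first split; first exact: (linset_cocycles _ _).1.
    exists 0; first exact: (linset_coboundaries _ _).1.
    by exists 0 => x; rewrite !hom0E linear0.
  move=> c f f' [hf [w hw [g fg wg]]] [hf' [w' hw' [g' fg' wg']]].
  split; first exact: (linset_cocycles _ _).2.
  exists (c *: w + w'); first exact: (linset_coboundaries _ _).2.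
  exists (c *: g + g') => x.
    by rewrite !homDE !homZE linearP fg fg'.
  by rewrite !homDE !homZE linearP wg wg'.
- exact: linset_coboundaries.
- by move=> f [hf [w hw [g fg wg]]]; apply: connecting_eq0 wg.
Qed.

Lemma Ext_quotient i :
  fg_mod (@cocycles A i) (@coboundaries A i) ->
  fg_mod (@cocycles A1 i.+1) (@coboundaries A1 i.+1) ->
  fg_mod (@cocycles A2 i) (@coboundaries A2 i).
Proof.
move=> fgA; apply: Ext_quotient_of_image.
apply: (@fg_rel_sub _ hR _ _ (fun (f : Hom (F i) A2) (w : Hom (F i) A) =>
  forall x, f x = pr (w x)) _ _ _ _ _ _ _ _ fgA).
- split; first by exists 0; [exact: (linset_cocycles _ _).1|move=> x; rewrite !hom0E linear0].
  move=> c f f' [g hg fg] [g' hg' fg']; exists (c *: g + g').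
    exact: (linset_cocycles _ _).2.
  by move=> x; rewrite !homDE !homZE linearP fg fg'.
- exact: linset_coboundaries.
- by move=> x; rewrite !hom0E linear0.
- by move=> c f g w w' fw gw x; rewrite !homDE !homZE linearP fw gw.
- by move=> f [g]; exists g.
- move=> f w _ hw fw.
  have -> : f = hom_comp pr w by apply: hom_eq.
  exact: coboundaries_comp.
Qed.

End ShortExact.
End Cochains.

(** * Homotopies on the free resolution *)

Section HomotopyModuloSmall.
Variables (R : comPzRingType) (T : lmodType R).
Local Notation F i := (resolution T i).

(** [small] stands for a class of maps to be neglected: the maps of finitely
    generated image, or just the zero maps. *)
Variable small : forall U V : lmodType R, (U -> V) -> Prop.
Hypothesis small_comp : forall (U V W : lmodType R) (f : V -> W) (g : U -> V),
  small f -> small (f \o g).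
Hypothesis small_lift : forall i (X : lmodType R) (d : {linear F i -> X})
  (g : Hom (F i) (F i)), small (fun y => d (g y)) ->
  exists2 theta : Hom (F i) (F i), small theta &
    forall y, d (theta y) = d (g y).

(** If multiplication by [c] is small on [T], then in each degree of the resolution
    it is homotopic to a small map [theta].  With [h'] the homotopy of the
    previous degree, [p] the composite of [h'] with the differential and [d] the
    map out of [F j], the invariant is that [d (c - p)] is small: a small lift
    [theta] of it makes [c - p - theta] land in the kernel of [d], and lifting this
    through the next differential gives the next homotopy. *)
Lemma homotopy_mod_small (c : R) : small (fun y : F 0 => c *: free_eval y : T) ->
  forall i, exists2 theta : Hom (F i) (F i), small theta &
    forall (M : lmodType R) (f : Hom (F i) M), cocycles f ->
      coboundaries (c *: f - hom_comp f theta).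
Proof.
move=> small0 i.
have step j (X : lmodType R) (d : {linear F j -> X}) (p : Hom (F j) (F j)) :
    (forall y, d y = 0 -> exists x, differential x = y) ->
    small (fun y => d (c *: y - p y)) ->
    exists2 theta : Hom (F j) (F j), small theta &
    exists h : Hom (F j) (F j.+1), forall y,
      c *: y - p y = theta y + differential (h y).
  move=> ex sm; pose g : Hom (F j) (F j) := c *: hom_id (F j) - p.
  have [theta smt dt] := small_lift (g := g) sm; exists theta => //.
  have [|h hE] := @hom_lift _ _ _ _ (@differential R T j) j (g - theta).
    by move=> x; apply: ex; rewrite linearB /= dt subrr.
  by exists h => y; rewrite hE /= [_ + (_ - _)]addrC subrK.
suff [p [pd pcob [theta smt [h hE]]]] : exists p : Hom (F i) (F i),
    [/\ forall y, p (differential y) = 0,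
        forall M (f : Hom (F i) M), coboundaries (hom_comp f p) &
        exists2 theta : Hom (F i) (F i), small theta &
        exists h : Hom (F i) (F i.+1), forall y,
          c *: y - p y = theta y + differential (h y)].
  exists theta => // M f fc.
  have -> : c *: f - hom_comp f theta = hom_comp f p.
    apply: hom_eq => y; rewrite /= -linearZ -[c *: y](subrK (p y)) hE.
    by rewrite !linearD /= fc addr0 [_ + f (p y)]addrC addrK.
  exact: pcob.
elim: i => [|i [p [pd pcob [theta smt [h hE]]]]].
  exists 0; split=> // [M f|].
    by apply: hom_eq => y; rewrite /= linear0.
  apply: (step 0%N T (@free_eval R T : {linear free_module R T -> T}) 0) => [y /differential0_exact//|].
  congr (small _): small0; apply/funext => y.
  by rewrite subr0 linearZ.
exists (hom_comp h (hom_diff T i)); split=> [y|M f|].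
- by rewrite hom_compE hom_diffE differential2 linear0.
- by exists (hom_comp f h).
apply: (step _ _ (@differential R T i)) => [y /differential_exact//|].
congr (small _): (small_comp (@differential R T i) smt).
apply/funext => y; rewrite hom_compE hom_diffE linearB linearZ /=.
have := hE (differential y); rewrite pd subr0 => ->.
by rewrite addrK.
Qed.

End HomotopyModuloSmall.

Section FiniteSpan.
Variable R : comPzRingType.
Hypothesis hR : noetherian_ring R.

Definition finite_span (U V : lmodType R) (f : U -> V) : Prop :=
  exists ys : seq V, forall u, adjoin ys [set 0] (f u).

Lemma adjoin_image (U V : lmodType R) (phi : {linear U -> V}) (us : seq U) v :
  adjoin (map phi us) [set 0] v -> exists2 u, adjoin us [set 0] u & phi u = v.
Proof.
have hus := linset_adjoin us (@linset0 R U).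
apply: (@adjoin_sub _ _ _ _ [set v | exists2 u, adjoin us [set 0] u & phi u = v]).
- split; first by exists 0; [case: hus|rewrite linear0].
  move=> c _ _ [x hx <-] [y hy <-]; exists (c *: x + y); last exact: linearP.
  by case: hus => _; apply.
- by move=> _ ->; exists 0; [case: hus|rewrite linear0].
- move=> _ /mapP[u uus ->]; exists u => //; apply: mem_adjoin => //.
  exact: linset0.
Qed.

(** Over a noetherian ring the image of [d g] is generated by finitely many
    [d (g y)]; the free module is mapped into the span of the corresponding
    elements [g y]. *)
Lemma finite_span_lift (S : choiceType) (X Y : lmodType R)
    (d : {linear Y -> X}) (g : {linear free_module R S -> Y}) :
  finite_span (fun y => d (g y)) ->
  exists2 theta : {linear free_module R S -> Y}, finite_span theta &
    forall y, d (theta y) = d (g y).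
Proof.
move=> [ys hys].
have [||||ws Wws hws] := @fg_mod_subset _ hR _
  [set w | exists y, w = d (g y)] (adjoin ys [set 0]) [set 0].
- split; first by exists 0; rewrite !linear0.
  by move=> c _ _ [y ->] [y' ->]; exists (c *: y + y'); rewrite !linearP.
- exact: linset0.
- by move=> _ [y ->].
- exists ys => // y hy; apply: mem_adjoin => //; exact: linset0.
have /choice[k hk] : forall w, exists z, w \in ws -> d z = w.
  move=> w; case: (boolP (w \in ws)) => [/Wws[y ->]|_]; last by exists 0.
  by exists (g y).
pose zs := map k ws.
have zsE : map d zs = ws.
  rewrite -map_comp -[RHS]map_id; by apply/eq_in_map => w; apply: hk.
pose Z := submod_of (linset_adjoin zs (@linset0 R Y)).
have [|theta hth] := @free_projective R S (submodule_type Z) X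
    (d \o @submodule_incl _ _ Z) (d \o g).
  move=> x; have [|z hz dz] := @adjoin_image _ _ d zs (d (g x)).
    by rewrite zsE; apply: hws; exists x.
  have zZ : z \in Z by apply/(in_submod_of (linset_adjoin zs (@linset0 R Y))).
  by exists (exist _ z zZ).
exists (@submodule_incl _ _ Z \o theta) => //.
exists zs => u; apply/(in_submod_of (linset_adjoin zs (@linset0 R Y))).
exact: mem_submodule_incl.
Qed.

Variable T : lmodType R.

(** The identity is homotopic to a map [theta] of finitely generated image, so a
    cocycle is determined up to coboundaries by its values on the finitely many
    generators of that image. *)
Lemma Ext_fg_fg (N : lmodType R) i :
  finitely_generated T -> finitely_generated N ->
  fg_mod (@cocycles R T N i) (@coboundaries R T N i).
Proof.
move=> /finitely_generatedP[ts _ hts] /finitely_generatedP fgN.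
have [|||theta [zs hzs] hth] := @homotopy_mod_small R T finite_span _ _ 1 _ i.
- by move=> U V W f g [ys hys]; exists ys => u; apply: hys.
- by move=> j X d g; apply: finite_span_lift.
- by exists ts => u; apply: hts.
apply: (@fg_mod_forall _ hR (resolution T i) (Hom (resolution T i) N) N
  (fun z f => f z) zs _ _ _ _ _ _ _ fgN).
- by move=> z c f g; rewrite homDE homZE.
- exact: linset_cocycles.
- exact: linset0.
- by [].
apply: fg_mod_sub => f [fc f0].
have := hth N f fc; congr (coboundaries _); apply: hom_eq => y.
have : adjoin zs [set 0] `<=` [set z | f z = 0].
  apply: adjoin_sub => [|_ ->|z /f0//]; last exact: linear0.
  split=> [|c u v /= fu fv]; first exact: linear0.
  by rewrite linearP fu fv scaler0 addr0.
move=> /(_ _ (hzs y)) /= E.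
by rewrite E scale1r subr0.
Qed.

(** Multiplication by [x] is zero on [T], hence null-homotopic on the resolution. *)
Lemma Ext_scalar_zero (x : R) : (forall t : T, x *: t = 0) ->
  forall (M : lmodType R) i (f : Hom (resolution T i) M), cocycles f ->
  coboundaries (x *: f).
Proof.
move=> xT M i f fc.
have [|||theta th0 hth] := @homotopy_mod_small R T
    (fun U V h => forall u, h u = 0) _ _ x _ i.
- by move=> U V W g h g0 u; apply: g0.
- by move=> j X d g dg; exists 0 => // y; rewrite dg hom0E linear0.
- by move=> u; apply: xT.
have := hth M f fc; congr (coboundaries _); apply: hom_eq => y.
by rewrite /= th0 linear0 subr0.
Qed.

(** Multiplication by [x] is onto on [C] and zero on cohomology, so H^i(C) embeds
    into H^(i+1)(K). *)
Lemma Ext_divisible (x : R) (K C : lmodType R) (inc : {linear K -> C}) i :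
  (forall t : T, x *: t = 0) -> injective inc ->
  (forall z : C, exists y, x *: y = z) ->
  (forall z : C, x *: z = 0 <-> exists k, inc k = z) ->
  fg_mod (@cocycles R T K i.+1) (@coboundaries R T K i.+1) ->
  fg_mod (@cocycles R T C i) (@coboundaries R T C i).
Proof.
move=> xT inj onto ex.
pose mx : {linear C -> C} := (x *: hom_id C : Hom C C).
apply: (@Ext_quotient_of_image _ _ hR _ _ _ inc mx) => //.
apply: fg_mod_sub => f [g gc fg].
have -> : f = x *: g by apply: hom_eq.
exact: Ext_scalar_zero.
Qed.

End FiniteSpan.

(** * Cofiniteness of artinian modules *)

Section HomFromCyclic.
Variable R : comPzRingType.
Hypothesis hR : noetherian_ring R.

Definition bundle_linear (U V : lmodType R) (f : U -> V) (hf : linear f) :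
  {linear U -> V} := HB.pack f (GRing.isLinear.Build R U V *:%R f hf).

Lemma quotient_lift (V A : lmodType R) (N : submodClosed V)
    (phi : {linear V -> A}) : (forall v, v \in N -> phi v = 0) ->
  exists psi : {linear quotient_module N -> A},
    forall v, psi (quotient_map N v) = phi v.
Proof.
move=> phiN.
pose f (q : quotient_module N) := phi (repr q).
have fE v : f (quotient_map N v) = phi v.
  apply/eqP; rewrite -subr_eq0 -linearB; apply/eqP/phiN/quotient_mapP.
  exact: quotient_map_surj.
suff f_lin : linear f by exists (bundle_linear f_lin).
move=> c p q; have [u <-] := quotient_map_onto p.
have [v <-] := quotient_map_onto q.
by rewrite -linearP !fE linearP.
Qed.

Lemma free_eval_basis (T : lmodType R) (t : T) : free_eval (free_basis R t) = t.
Proof.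
rewrite (@free_evalE _ _ _ [:: t])// => [|y].
  by rewrite big_seq1 free_coef_basis eqxx scale1r.
by rewrite free_coef_basis inE; case: (y == t) => //; rewrite eqxx.
Qed.

Variables (b : ideal R) (A : lmodType R).
Local Notation T := (quotient_module b).

Definition annihilated : set A := [set z | forall r : R, r \in b -> r *: z = 0].

Lemma linset_annihilated : linset annihilated.
Proof.
split=> [r _|c z z' hz hz' r rb]; first by rewrite scaler0.
by rewrite scalerDr scalerA mulrC -scalerA hz// hz'// scaler0 addr0.
Qed.

Let u : T := quotient_map b (1 : R^o).

Let quotient_mapE (r : R) : quotient_map b (r : R^o) = r *: u.
Proof. by rewrite /u -linearZ; congr quotient_map; rewrite [RHS]mulr1. Qed.

(** A cocycle of degree 0 is a map out of the cyclic module [R/b], determined by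
    the image of the generator; this identifies Ext^0 with the [b]-socle. *)
Lemma fg_Ext0 : fg_mod (@cocycles R T A 0) (@coboundaries R T A 0) <->
  fg_mod annihilated [set 0].
Proof.
have cocycle_eq0 (f : Hom (resolution T 0) A) y :
    cocycles f -> free_eval y = 0 -> f y = 0.
  by move=> fc /differential0_exact[x <-]; apply: fc.
split=> fg.
  apply: (@fg_rel_sub _ hR A (Hom (resolution T 0) A)
    (fun z f => f (free_basis R u) = z) _ _ _ _ _ _ _ _ fg).
  - exact: linset_annihilated.
  - exact: linset_coboundaries.
  - by rewrite hom0E.
  - by move=> c z z' f f' <- <-; rewrite homDE homZE.
  - move=> z hz.
    have mul_lin : linear (fun r : R^o => (r : R) *: z).
      by move=> c r s; rewrite scalerDl scalerA.
    have [|psi psiE] := @quotient_lift R^o A b (bundle_linear mul_lin).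
      exact: hz.
    exists (psi \o @free_eval R T : {linear free_module R T -> A}).
      move=> x /=; have -> : free_eval (differential x) = 0 :> T.
        by apply/differential0_exact; exists x.
      exact: linear0.
    by rewrite /= free_eval_basis psiE /= scale1r.
  - move=> z f _ hf <-; have -> : f = 0 by exact: hf.
    by rewrite hom0E.
apply: (@fg_rel_sub _ hR (Hom (resolution T 0) A) A
  (fun f z => f (free_basis R u) = z) _ _ _ _ _ _ _ _ fg).
- exact: linset_cocycles.
- exact: linset0.
- by rewrite hom0E.
- by move=> c f f' z z' <- <-; rewrite homDE homZE.
- move=> f fc; exists (f (free_basis R u)) => // r rb; rewrite -linearZ.
  apply: cocycle_eq0 => //; rewrite linearZ /= free_eval_basis -quotient_mapE.
  exact/quotient_map_eq0.
- move=> f _ fc -> fu; apply: hom_eq => y; rewrite hom0E.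
  have [r hr] := quotient_map_onto (free_eval y).
  have -> : f y = f (y - r *: free_basis R u) + r *: f (free_basis R u).
    by rewrite -linearZ -linearD subrK.
  rewrite fu scaler0 addr0.
  apply: cocycle_eq0 => //.
  by rewrite linearB linearZ /= free_eval_basis -quotient_mapE hr subrr.
Qed.

Lemma cyclic_fg : finitely_generated T.
Proof.
apply/finitely_generated_quotient => //; exists [:: 1 : R^o] => // r _ /=.
exists r; have -> : r *: (1 : R^o) = r by exact: mulr1.
by rewrite subrr /=; apply: (rpred0 b).
Qed.

Lemma cyclic_annihilated (x : R) : x \in b -> forall t : T, x *: t = 0.
Proof.
move=> xb t; have [r <-] := quotient_map_onto t.
rewrite -linearZ; apply/quotient_map_eq0.
by rewrite /= [x *: r]mulrC; apply: (@rpredZ _ _ b r x).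
Qed.

End HomFromCyclic.

Lemma adjoin_annihilates (R : comPzRingType) (xs : seq R) (A : lmodType R)
    (z : A) : (forall x, x \in xs -> x *: z = 0) ->
  forall r : R, @adjoin R R^o xs [set 0] r -> r *: z = 0.
Proof.
move=> hz.
apply: (@adjoin_sub R R^o xs [set 0] [set r : R^o | (r : R) *: z = 0]) => //.
- split=> [|c y y' hy hy'] /=; first by rewrite scale0r.
  by rewrite scalerDl -scalerA hy hy' scaler0 addr0.
- by move=> _ ->; rewrite /= scale0r.
Qed.

Lemma ideal_generated (R : comPzRingType) (xs : seq R) : exists2 b : ideal R,
  forall x, x \in xs -> x \in b & forall (A : lmodType R) (z : A),
    (forall x, x \in xs -> x *: z = 0) -> forall r, r \in b -> r *: z = 0.
Proof.
have hxs := @linset_adjoin R R^o xs _ (linset0 R^o).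
exists (submod_of hxs) => [x xxs|A z hz r /(in_submod_of hxs)].
  by apply/(in_submod_of hxs); apply: mem_adjoin => //; exact: linset0.
exact: adjoin_annihilates.
Qed.

Section ArtinianCofinite.
Variable R : comPzRingType.
Hypothesis hR : noetherian_ring R.

(** [N] is the step [x^k A] at which the chain of these submodules stabilises. *)
Lemma divisible_part (A : lmodType R) (x : R) : dcc [set: A] [set 0] ->
  exists (k : nat) (N : submodClosed A),
    (forall z, x ^+ k *: z \in N) /\
    (forall z : submodule_type N, exists y, x *: y = z).
Proof.
move=> dA.
pose L (k : nat) : set A := [set z | exists y, z = x ^+ k *: y].
have hL k : linset (L k).
  split; first by exists 0; rewrite scaler0.
  move=> c _ _ [y ->] [y' ->]; exists (c *: y + y').
  by rewrite scalerDr !scalerA mulrC.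
have [||||k hk] := dA L => //.
- by move=> k _ ->; case: (hL k).
- by move=> k _ [y ->]; exists (x *: y); rewrite scalerA -exprSr.
have xkN y : x ^+ k *: y \in submod_of (hL k).
  by apply/(in_submod_of (hL k)); exists y.
exists k, (submod_of (hL k)); split=> // z.
have /(in_submod_of (hL k)) zL := mem_submodule_incl z.
have [y yE] := hk k.+1 _ zL.
have [w wE] := (submodule_incl_image _ _).1 (xkN y); exists w.
by apply: submodule_incl_inj; rewrite linearZ /= wE yE exprS -scalerA.
Qed.

(** The submodules [0 :_Q x^j] of the [xs]-socle are reached one step at a time. *)
Lemma fg_socle_of_pow_killed (Q : lmodType R) (x : R) (xs : seq R) (k : nat) :
  (forall q : Q, x ^+ k *: q = 0) ->
  fg_mod (tors (x :: xs) 1 : set Q) [set 0] ->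
  fg_mod (tors xs 1 : set Q) [set 0].
Proof.
move=> xk0 fgQ1; have hT := linset_tors Q xs 1.
have hS j : linset [set z : Q | tors xs 1 z /\ x ^+ j *: z = 0].
  split=> [|e z z' [hz xz] [hz' xz']].
    by split; [case: hT|exact: scaler0].
  split; first exact: hT.2.
  by rewrite scalerDr scalerA mulrC -scalerA xz xz' scaler0 addr0.
have fgS j : fg_mod [set z : Q | tors xs 1 z /\ x ^+ j *: z = 0] [set 0].
  elim: j => [|j IHj].
    by apply: fg_mod_sub => z [_]; rewrite expr0 scale1r.
  apply: (@fg_mod_forall _ hR _ Q Q (fun y z => y *: z) [:: x]
    _ _ _ _ _ _ _ IHj).
  + by move=> y e z z' /=; rewrite scalerDr !scalerA mulrC.
  + exact: hS.
  + exact: linset0.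
  + move=> y z; rewrite inE => /eqP -> [hz xz]; split.
      exact: (linsetZ x hT hz).
    by rewrite scalerA -exprSr.
  apply: fg_mod_subset fgQ1 => //; last 1 first.
  + move=> z [[hz _] xz] y; rewrite inE => /orP[/eqP->|/hz//].
    by apply: xz; rewrite mem_head.
  + split=> [|e z z' [hz xz] [hz' xz']].
      by split=> [|y _]; [case: (hS j.+1)|rewrite /= scaler0].
    split; first exact: (hS j.+1).2.
    move=> y yx; rewrite /= scalerDr scalerA mulrC -scalerA.
    by rewrite (xz y yx) (xz' y yx) scaler0 addr0.
  + exact: linset0.
by apply: fg_mod_subset (fgS k) => //; exact: linset0.
Qed.

(** With [C] the stable value of [x^k A], [K] the kernel of [x] on [C] and [Q] the
    quotient [A/C], the induction hypothesis for [xs] applies to [K] and, once [C]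
    is known to be cofinite, to [Q].  The ideal [b] is left free because the socle
    of [Q] is controlled through the ideal generated by [x :: xs]. *)
Lemma Ext_artinian (xs : seq R) : forall A : lmodType R,
  dcc [set: A] [set 0] ->
  (forall x (z : A), x \in xs -> exists k, x ^+ k *: z = 0) ->
  fg_mod (tors xs 1 : set A) [set 0] ->
  forall (b : ideal R), (forall x, x \in xs -> x \in b) -> forall i,
  fg_mod (@cocycles R (quotient_module b) A i)
    (@coboundaries R (quotient_module b) A i).
Proof.
elim: xs => [|x xs IH] A dA torsA fgA b xsb i.
  apply: Ext_fg_fg => //; first exact: cyclic_fg.
  apply/finitely_generatedP; apply: fg_mod_subset fgA => //.
  exact: linset0.
have [k [N [xkN onto]]] := divisible_part x dA.
pose C : lmodType R := submodule_type N.
pose K : lmodType R := submodule_type (ann_elt C x).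
pose incK : {linear K -> A} :=
  (@submodule_incl _ _ N \o @submodule_incl _ _ (ann_elt C x) : {linear K -> A}).
have incK_inj : injective incK.
  by move=> y z /submodule_incl_inj/submodule_incl_inj.
have incKx z : x *: incK z = 0.
  have xz : x *: submodule_incl z = 0 by apply/eqP/(mem_submodule_incl z).
  by rewrite /incK /= -linearZ xz linear0.
have fgK : forall c : ideal R, (forall y, y \in x :: xs -> y \in c) -> forall j,
    fg_mod (@cocycles R (quotient_module c) K j)
      (@coboundaries R (quotient_module c) K j).
  move=> c xsc j; apply: IH.
  - exact: (dcc_inj incK_inj dA).
  - move=> y z yxs; have [|l hl] := torsA y (incK z); first by rewrite inE yxs orbT.
    by exists l; apply: incK_inj; rewrite linearZ linear0.
  - apply: (@fg_rel_sub _ hR K A (fun z w => incK z = w) _ _ _ _ _ _ _ _ fgA).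
    + exact: linset_tors.
    + exact: linset0.
    + exact: linear0.
    + by move=> e z z' w w' <- <-; rewrite linearP.
    + move=> z hz; exists (incK z) => // y; rewrite inE => /orP[/eqP->|yxs].
        exact: incKx.
      by rewrite -linearZ (hz y yxs) linear0.
    + by move=> z w _ -> hz; apply: incK_inj; rewrite hz linear0.
  - by move=> y yxs; apply: xsc; rewrite inE yxs orbT.
have fgC : forall c : ideal R, (forall y, y \in x :: xs -> y \in c) -> forall j,
    fg_mod (@cocycles R (quotient_module c) C j)
      (@coboundaries R (quotient_module c) C j).
  move=> c xsc j.
  apply: (@Ext_divisible _ hR _ x K C (@submodule_incl _ _ (ann_elt C x))).
  - by apply: cyclic_annihilated; apply: xsc; rewrite mem_head.
  - exact: submodule_incl_inj.
  - exact: onto.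
  - move=> z; rewrite -submodule_incl_image.
    by split=> [xz|/eqP//]; apply/eqP.
  - exact: fgK.
pose Q : lmodType R := quotient_module N.
have exact_mid (a : A) : quotient_map N a = 0 <->
    exists a1 : C, submodule_incl a1 = a.
  by rewrite quotient_map_eq0 submodule_incl_image.
apply: (@Ext_extension _ _ hR C A Q (@submodule_incl _ _ N) (quotient_map N)) => //.
- exact: quotient_map_onto.
- exact: fgC.
(* The socle of [Q] sits between that of [A] and Ext^1(R/b0, C). *)
have fgQ1 : fg_mod (tors (x :: xs) 1 : set Q) [set 0].
  have [b0 xsb0 annb0] := ideal_generated (x :: xs).
  have fgA0 : fg_mod (@annihilated R b0 A) [set 0].
    apply: fg_mod_subset fgA => //; last 1 first.
    + by move=> z hz y /xsb0; apply: hz.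
    + exact: linset_annihilated.
    + exact: linset0.
  have : fg_mod (@annihilated R b0 Q) [set 0].
    apply/(fg_Ext0 hR).
    apply: (@Ext_quotient _ _ hR C A Q (@submodule_incl _ _ N) (quotient_map N)) => //.
    + exact: quotient_map_onto.
    + exact/(fg_Ext0 hR).
    + exact: fgC.
  apply: fg_mod_subset => //; [exact: linset_tors|exact: linset0|].
  by move=> z hz; apply: annb0.
apply: IH => //.
- apply: (dcc_surj (phi := quotient_map N) (B := [set 0])) => //.
    exact: quotient_map_onto.
  by move=> _ ->; apply: linear0.
- move=> y q yxs; have [z <-] := quotient_map_onto q.
  have [|l hl] := torsA y z; first by rewrite inE yxs orbT.
  by exists l; rewrite -linearZ /= hl linear0.
- apply: fg_socle_of_pow_killed fgQ1 => q.
  have [z <-] := quotient_map_onto q.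
  by rewrite -linearZ; apply/quotient_map_eq0.
- by move=> y yxs; apply: xsb; rewrite inE yxs orbT.
Qed.

End ArtinianCofinite.

(** * Cofinite minimax modules *)

Section Main.
Variables (R : comPzRingType) (a : ideal R) (M : lmodType R).
Hypothesis hR : noetherian_ring R.
Hypothesis hsupp : support_in_V a M.
Hypothesis hloc : locally_minimax M.

Lemma cofinite_minimax_of_fg_socle :
  finitely_generated (submodule_type (ann_ideal M a)) ->
  cofinite a M /\ minimax M.
Proof.
move=> /(finitely_generated_submodule hR) fgM.
have [xs xsa axs] := ideal_fg hR (linset_submod a).
have fg1 : fg_mod (tors xs 1 : set M) [set 0].
  apply: fg_mod_subset fgM => //; [exact: linset_tors|exact: linset0|].
  by move=> z hz; apply/asboolP => r /axs; apply: adjoin_annihilates.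
have htors := support_tors hR xsa hsupp.
have [k dk] := tors_cofinal_artinian hR hloc htors fg1.
pose N := submod_of (linset_tors M xs k).
have inN z : z \in N <-> tors xs k z := in_submod_of (linset_tors M xs k) z.
have fgN : finitely_generated (submodule_type N).
  apply/(finitely_generated_submodule hR).
  apply: fg_mod_subset (fg_tors hR k fg1) => //.
  - exact: linset_submod.
  - exact: linset0.
  - by move=> z /inN.
have dN : dcc [set: quotient_module N] [set 0].
  apply: dcc_surj dk; first exact: quotient_map_onto.
  by move=> z hz; apply/quotient_map_eq0/inN.
split; last by exists N; split=> //; apply: dcc_artinian.
split=> // i; apply/(fg_ExtP _ hR).
apply: (@Ext_extension _ _ hR (submodule_type N) M (quotient_module N)
  (@submodule_incl _ _ N) (quotient_map N)).
- exact: submodule_incl_inj.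
- exact: quotient_map_onto.
- by move=> z; rewrite quotient_map_eq0 submodule_incl_image.
- by apply: Ext_fg_fg => //; apply: cyclic_fg.
apply: (Ext_artinian hR dN) xsa _ => [x q xxs|].
  have [z <-] := quotient_map_onto q; have [l hl] := htors z.
  by exists l; rewrite -linearZ /= (tors_pow xxs hl) linear0.
apply: (@fg_mod_map _ hR _ _ (quotient_map N) _ _ _ _ _ _ (fg_tors hR k.+1 fg1)).
- exact: linset_tors.
- exact: linset0.
- move=> q hq; have [z zq] := quotient_map_onto q; exists z => // x xxs.
  by apply/inN/quotient_map_eq0; rewrite linearZ /= zq; apply: hq.
- by move=> _ ->; apply: linear0.
Qed.

End Main.

Theorem theorem2p6 (R : comPzRingType) (hR : noetherian_ring R) (a : ideal R)
    (M : lmodType R) (hsupp : support_in_V a M) (hloc : locally_minimax M) :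
  (finitely_generated (submodule_type (ann_ideal M a)) ->
     cofinite a M /\ minimax M)
  /\
  ((exists2 x : R, x \in a & cofinite a (submodule_type (ann_elt M x))) ->
     cofinite a M /\ minimax M).
Proof.
split; first exact: cofinite_minimax_of_fg_socle.
move=> [x xa [_ /(_ 0%N) /(fg_ExtP _ hR) /(fg_Ext0 hR) fgK]].
apply: cofinite_minimax_of_fg_socle => //.
apply/(finitely_generated_submodule hR).
apply: (@fg_mod_map _ hR _ _ (@submodule_incl _ _ (ann_elt M x)) _ _ _ _ _ _ fgK).
- exact: linset_submod.
- exact: linset0.
- move=> z /asboolP hz.
  have zx : z \in ann_elt M x by apply/eqP; apply: hz.
  have [w wz] := (submodule_incl_image _ _).1 zx; exists w => // r ra.
  by apply: submodule_incl_inj; rewrite linearZ linear0 /= wz; apply: hz.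
- by move=> _ ->; apply: linear0.
Qed.
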